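(* Let $0<\gamma<2$ and $Q=\frac{2}{\gamma}+\frac{\gamma}{2}$. Then $$\Upsilon_{\frac{\gamma}{2}}'(0)=\frac{2\pi}{\Gamma^2_{\frac{\gamma}{2}}(Q)}.$$
   Context: Let $\tau=4/\gamma^2$. $\Gamma_2(w|\tau)$ is the Barnes double gamma function with periods $1,\tau$, i.e. $\log\Gamma_2(w|\tau)=\partial_z|_{z=0}\zeta_2(z,w)$, where $\zeta_2(z,w)=\sum_{k_1,k_2\ge 0}(w+k_1+k_2\tau)^{-z}$ ($\operatorname{Re} w>0$, $\operatorname{Re} z>2$, analytically continued in $z$), extended meromorphically in $w$. It satisfies $\frac{\Gamma_2(w|\tau)}{\Gamma_2(w+\tau|\tau)}=\frac{\Gamma(w)}{\sqrt{2\pi}}$ and $\frac{\Gamma_2(w|\tau)}{\Gamma_2(w+1|\tau)}=\frac{\tau^{w/\tau-1/2}}{\sqrt{2\pi}}\Gamma(w/\tau)$. The (physicist's) double gamma function is $$\Gamma_{\frac{\gamma}{2}}(x)=\Bigl(\frac{2}{\gamma}\Bigr)^{\frac12(x-\frac{Q}{2})^2}\frac{\Gamma_2(\frac{2x}{\gamma}|\tau)}{\Gamma_2(\frac{Q}{\gamma}|\tau)},$$ and the Upsilon function is $\Upsilon_{\frac{\gamma}{2}}(x)=\frac{1}{\Gamma_{\gamma/2}(x)\,\Gamma_{\gamma/2}(Q-x)}$ (an entire function vanishing at $x=0$). *)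

(* Defs.v *)
(* Stdlib real numbers, with Coquelicot for complex numbers, power series and derivatives. *)
From Stdlib Require Import Reals.
From Coquelicot Require Import Coquelicot.

Open Scope R_scope.
Open Scope C_scope.

Definition Cexp (z : C) : C :=
  (exp (Re z) * cos (Im z), exp (Re z) * sin (Im z))%R.

(* Principal logarithm and principal power; [atan (Im / Re)] is the principal
   argument only when [0 < Re z], the only case in which they are used. *)
Definition Clog (z : C) : C := (ln (Cmod z), atan (Im z / Re z)).

Definition Cpower (a s : C) : C := Cexp (s * Clog a).

Definition analytic_at (f : C -> C) (z0 : C) : Prop :=
  exists (a : nat -> C) (r : posreal),
    forall z : C, Cmod (z - z0) < r ->
      @is_pseries C_AbsRing C_NormedModule a (z - z0) (f z).

(* A pole of order [S n].  Functions being total, a meromorphic function is given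
   the value 0 at its poles; as [/ 0 = 0], [/ f] then takes at a pole of [f] the
   value of its continuous extension. *)
Definition has_pole_at (f : C -> C) (z0 : C) : Prop :=
  f z0 = 0 /\
  exists (n : nat) (g : C -> C) (r : posreal),
    analytic_at g z0 /\ g z0 <> 0 /\
    forall z : C, z <> z0 -> Cmod (z - z0) < r -> f z = g z / (z - z0) ^ S n.

Definition meromorphic (f : C -> C) : Prop :=
  forall z0 : C, analytic_at f z0 \/ has_pole_at f z0.

(* [Z] is z |-> zeta_2(z, w), for Re w > 0: the analytic continuation to
   C \ {1, 2} of the double series, which converges absolutely for Re z > 2
   (so that it may be written as an iterated sum); 1 and 2 are its only poles. *)
Definition is_barnes_zeta2 (tau : R) (w : C) (Z : C -> C) : Prop :=
  (forall z : C, z <> 1 -> z <> 2 -> analytic_at Z z) /\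
  (forall z : C, 2 < Re z ->
     exists row : nat -> C,
       (forall k1 : nat,
          @is_series C_AbsRing C_NormedModule
            (fun k2 : nat => Cpower (w + INR k1 + INR k2 * tau) (- z)) (row k1)) /\
       @is_series C_AbsRing C_NormedModule row (Z z)).

(* [G2] is w |-> Gamma_2(w | tau): the meromorphic extension to C of
   exp (d/dz zeta_2(z, w) at z = 0), Re w > 0.  The identity theorem makes [Z],
   and then [G2], unique. *)
Definition is_barnes_gamma2 (tau : R) (G2 : C -> C) : Prop :=
  meromorphic G2 /\
  (forall w : C, 0 < Re w ->
     exists (Z : C -> C) (l : C),
       is_barnes_zeta2 tau w Z /\
       @is_derive C_AbsRing C_NormedModule Z (RtoC 0) l /\
       G2 w = Cexp l).

Definition Qgamma (gamma : R) : R := (2 / gamma + gamma / 2)%R.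

(* In the next two definitions [G2] stands for Gamma_2(. | 4 / gamma^2). *)
Definition double_gamma (gamma : R) (G2 : C -> C) (x : C) : C :=
  Cpower (2 / gamma)%R (/ 2 * (x - Qgamma gamma / 2) ^ 2)
  * (G2 (2 * x / gamma) / G2 (Qgamma gamma / gamma)).

Definition Upsilon (gamma : R) (G2 : C -> C) (x : C) : C :=
  1 / (double_gamma gamma G2 x * double_gamma gamma G2 (Qgamma gamma - x)).

(* Main.v *)
Require Import Defs.
From Stdlib Require Import Reals Lra Lia Psatz Factorial IndefiniteDescription Classical.
From Coquelicot Require Import Coquelicot.

(** Put [tau = 4 / gamma^2], so that [sqrt tau = 2 / gamma].  Near 0 the factor
    [Gamma_2 (2 x / gamma)] of Upsilon has a simple pole and all the others are
    continuous and nonzero.  Hence [Upsilon x = x * (k / D x)] with [D] continuous,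
    [D 0 <> 0], and the derivative at 0 is [k / D 0] ([Cderiv_id_div]).  After
    cancellation the claim says that the residue of [Gamma_2] at 0 is
    [sqrt tau / (2 pi) * Gamma_2 (1 + tau)] ([barnes_gamma2_residue]).

    The residue comes from differences of the double zeta function.  For [Re z > 2],
    [zeta_2 (z, w) - zeta_2 (z, w + tau)] is the sum of the [(w + k)^(-z)], and
    [zeta_2 (z, w) - zeta_2 (z, w + 1)] that of the [(w + k tau)^(-z)].  Both
    differences are analytic at [z = 0], so the analytic continuation of these sums is
    given in advance.  Taking derivatives at [z = 0] and exponentials,
    - [w = 1] gives [Gamma_2 (1) / Gamma_2 (1 + tau) = exp (zeta' 0)], with the Riemann
      zeta function;
    - [w = tau] gives [Gamma_2 (tau) / Gamma_2 (tau + 1)] as the exponential of the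
      derivative at 0 of [tau^(-z) zeta z];
    - the second difference [w^(-z)] gives
      [w Gamma_2 (w) Gamma_2 (w + 1 + tau) = Gamma_2 (w + tau) Gamma_2 (w + 1)].
    Letting the positive real [w] tend to 0 in the last identity shows that the pole is
    simple and that its residue is [Gamma_2 (tau) Gamma_2 (1) / Gamma_2 (1 + tau)].
    The limit in [w] is taken on [Gamma_2], which is continuous at 1, [tau] and
    [1 + tau]; the zeta functions are only compared at fixed [w].

    An identity valid for [Re z > 2] is carried to a neighbourhood of 0 by the identity
    theorem along the segment from [3 + i] to 0, which avoids the poles 1 and 2
    ([continuation_unique]).

    Finally [zeta 0 = -1/2] and [zeta' 0 = - ln (2 pi) / 2] ([zeta_at_0]).  The series
    of second differences
    [(2m+1)^(-z) - 2 (2m+2)^(-z) + (2m+3)^(-z)] is analytic for [Re z >= 0] and equals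
    [2 (1 - 2^(1-z)) zeta z - 1].  At 0 its terms vanish, and the derivatives of its
    terms are the logarithms of the factors of the Wallis product for [pi / 2].

    Analyticity means here convergence of a power series, so the analyticity of an
    infinite sum must be proved on coefficients.  The norm [sum |a_k| r^k] of an
    expansion is subadditive and submultiplicative, and a series of functions whose
    norms are summable is again an expansion, obtained by summing the coefficients
    ([expands_series]). *)

Local Open Scope R_scope.
Local Open Scope C_scope.

(** * Series of complex numbers *)

(** A constant typed over [C], on which the ring tactics work, in place of the generic
    [sum_n]. *)
Definition Csum (u : nat -> C) (n : nat) : C := @sum_n C_AbelianMonoid u n.

Notation Csums := (@is_series C_AbsRing C_NormedModule).
Notation Cderiv := (@is_derive C_AbsRing C_NormedModule).

Lemma Csum_S (u : nat -> C) (n : nat) : Csum u (S n) = Csum u n + u (S n).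
Proof. exact (sum_Sn u n). Qed.

Lemma Rsum_S (u : nat -> R) (n : nat) : sum_n u (S n) = (sum_n u n + u (S n))%R.
Proof. exact (sum_Sn u n). Qed.

(** The uniform structure of [C] is that of the product of two copies of [R]; the
    two distances differ by a factor at most [sqrt 2]. *)
Lemma Csums_iff (u : nat -> C) (l : C) :
  Csums u l <->
  forall eps : R, (0 < eps)%R ->
    exists N : nat, forall n : nat, (N <= n)%nat -> (Cmod (Csum u n - l) < eps)%R.
Proof.
  split.
  - intros H eps Heps.
    assert (He : (0 < eps / sqrt 2)%R).
    { apply Rdiv_lt_0_compat; [exact Heps | apply sqrt_lt_R0; lra]. }
    destruct (H (ball l (mkposreal _ He)) (locally_ball l (mkposreal _ He))) as [N HN].
    exists N. intros n Hn.
    pose proof (C_NormedModule_mixin_compat2 l (Csum u n) (mkposreal _ He) (HN n Hn)) as K.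
    simpl in K.
    replace (sqrt 2 * (eps / sqrt 2))%R with eps in K.
    + exact K.
    + field. apply Rgt_not_eq, sqrt_lt_R0; lra.
  - intros H P [eps HP].
    destruct (H eps (cond_pos eps)) as [N HN].
    exists N. intros n Hn. apply HP.
    apply C_NormedModule_mixin_compat1. exact (HN n Hn).
Qed.

Lemma Cderiv_iff (f : C -> C) (z l : C) :
  Cderiv f z l <->
  forall eps : R, (0 < eps)%R ->
    exists d : R, (0 < d)%R /\ forall y : C, (Cmod (y - z) < d)%R ->
      (Cmod (f y - f z - (y - z) * l) <= eps * Cmod (y - z))%R.
Proof.
  split.
  - intros [_ H] eps Heps.
    destruct (H z (fun P HP => HP) (mkposreal eps Heps)) as [d Hd].
    exists d. split; [apply cond_pos | intros y Hy].
    exact (Hd y Hy).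
  - intros H. split; [apply is_linear_scal_l |].
    intros x Hx.
    assert (x = z) as ->.
    { symmetry.
      exact (@is_filter_lim_locally_unique C_AbsRing (AbsRing_NormedModule C_AbsRing) z x Hx). }
    intros eps. destruct (H eps (cond_pos eps)) as [d [Hd K]].
    exists (mkposreal d Hd). intros y Hy. exact (K y Hy).
Qed.

Lemma Csums_unique (u : nat -> C) (l1 l2 : C) : Csums u l1 -> Csums u l2 -> l1 = l2.
Proof.
  intros H1 H2. exact (filterlim_locally_unique (T := nat) (F := eventually) _ _ _ H1 H2).
Qed.

Lemma Csums_ext (u v : nat -> C) (l : C) :
  (forall n, u n = v n) -> Csums u l -> Csums v l.
Proof. exact (is_series_ext u v l). Qed.

Lemma Csum_ext (u v : nat -> C) (n : nat) : (forall k, u k = v k) -> Csum u n = Csum v n.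
Proof. exact (sum_n_ext u v n). Qed.

Lemma Csums_plus (u v : nat -> C) (l m : C) :
  Csums u l -> Csums v m -> Csums (fun n => u n + v n) (l + m).
Proof. exact (is_series_plus u v l m). Qed.

Lemma Csums_minus (u v : nat -> C) (l m : C) :
  Csums u l -> Csums v m -> Csums (fun n => u n - v n) (l - m).
Proof. exact (is_series_minus u v l m). Qed.

Lemma Csums_scal (c : C) (u : nat -> C) (l : C) :
  Csums u l -> Csums (fun n => c * u n) (c * l).
Proof. exact (is_series_scal c u l). Qed.

Lemma Csums_tail (u : nat -> C) (l : C) :
  Csums u l -> Csums (fun n => u (S n)) (l - u 0%nat).
Proof.
  intros H. apply (is_series_incr_1 u).
  refine (eq_ind l (fun x : C => Csums u x) H _ _).
  change (l = l - u 0%nat + u 0%nat). ring.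
Qed.

Lemma Csums_cons (u : nat -> C) (l : C) :
  Csums (fun n => u (S n)) l -> Csums u (u 0%nat + l).
Proof.
  intros H. apply (is_series_decr_1 u).
  refine (eq_ind l (fun x : C => Csums (fun n => u (S n)) x) H _ _).
  change (l = u 0%nat + l + - u 0%nat). ring.
Qed.

Lemma Csums_zero : Csums (fun _ => RtoC 0) (RtoC 0).
Proof.
  apply Csums_iff. intros eps He. exists 0%nat. intros n _.
  replace (Csum (fun _ => 0) n) with (RtoC 0).
  - replace (0 - 0) with (RtoC 0) by ring. rewrite Cmod_0. exact He.
  - induction n as [|n IH].
    + unfold Csum. now rewrite sum_O.
    + rewrite Csum_S, <- IH. ring.
Qed.

Lemma Rsum_nonneg (u : nat -> R) (n : nat) : (forall k, (0 <= u k)%R) -> (0 <= sum_n u n)%R.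
Proof.
  intros H. induction n as [|n IH].
  - rewrite sum_O. apply H.
  - rewrite Rsum_S. specialize (H (S n)). lra.
Qed.

Lemma Rsum_le (u v : nat -> R) (n : nat) :
  (forall k, (u k <= v k)%R) -> (sum_n u n <= sum_n v n)%R.
Proof.
  intros H. induction n as [|n IH].
  - rewrite !sum_O. apply H.
  - rewrite !Rsum_S. specialize (H (S n)). lra.
Qed.

Lemma Rsum_term_le (u : nat -> R) (M : R) (n : nat) :
  (forall k, (0 <= u k)%R) -> (forall N, (sum_n u N <= M)%R) -> (u n <= M)%R.
Proof.
  intros H HM. destruct n as [|n].
  - specialize (HM 0%nat). rewrite sum_O in HM. exact HM.
  - specialize (HM (S n)). rewrite Rsum_S in HM.
    pose proof (Rsum_nonneg u n H). lra.
Qed.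

Lemma Rsum_ext (u v : nat -> R) (n : nat) : (forall k, u k = v k) -> sum_n u n = sum_n v n.
Proof. exact (sum_n_ext u v n). Qed.

Lemma Rsum_scal (c : R) (u : nat -> R) (n : nat) :
  sum_n (fun k => (c * u k)%R) n = (c * sum_n u n)%R.
Proof. exact (sum_n_mult_l (K := R_Ring) c u n). Qed.

Lemma Cmod_Csum_le (u : nat -> C) (n : nat) :
  (Cmod (Csum u n) <= sum_n (fun k => Cmod (u k)) n)%R.
Proof.
  induction n as [|n IH].
  - unfold Csum. rewrite !sum_O. apply Rle_refl.
  - rewrite Csum_S, Rsum_S. pose proof (Cmod_triangle (Csum u n) (u (S n))). lra.
Qed.

Lemma Csums_Cmod_le (u : nat -> C) (l : C) (M : R) :
  Csums u l -> (forall N, (Cmod (Csum u N) <= M)%R) -> (Cmod l <= M)%R.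
Proof.
  intros H HM. apply Rnot_lt_le. intros Hlt.
  destruct (proj1 (Csums_iff u l) H (Cmod l - M)%R) as [N HN]; [lra |].
  specialize (HN N (Nat.le_refl N)). specialize (HM N).
  pose proof (Cmod_triangle (Csum u N) (-(Csum u N - l))) as K.
  rewrite Cmod_opp in K.
  replace (Csum u N + - (Csum u N - l)) with l in K by ring. lra.
Qed.

Lemma ex_series_bounded (u : nat -> R) (M : R) :
  (forall n, (0 <= u n)%R) -> (forall N, (sum_n u N <= M)%R) -> ex_series u.
Proof.
  intros H HM.
  destruct (ex_finite_lim_seq_incr (sum_n u) M) as [l Hl].
  - intros n. rewrite Rsum_S. specialize (H (S n)). lra.
  - exact HM.
  - exists l. exact Hl.
Qed.

Lemma Csums_abs (u : nat -> C) (M : R) :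
  (forall N, (sum_n (fun k => Cmod (u k)) N <= M)%R) -> exists l : C, Csums u l.
Proof.
  intros HM.
  apply (ex_series_le (K := C_AbsRing) (V := C_CompleteNormedModule) u (fun k => Cmod (u k))).
  - intros n. apply Rle_refl.
  - apply (ex_series_bounded _ M); [intros; apply Cmod_ge_0 | exact HM].
Qed.

Lemma summable_tail (M : nat -> R) (S0 eps : R) :
  (forall n, (0 <= M n)%R) -> (forall N, (sum_n M N <= S0)%R) -> (0 < eps)%R ->
  exists N, forall n, (N <= n)%nat -> (sum_n M n - sum_n M N < eps)%R.
Proof.
  intros H0 HS He.
  destruct (ex_series_bounded M S0 H0 HS) as [l Hl].
  change (is_lim_seq (sum_n M) l) in Hl.
  apply is_lim_seq_spec in Hl.
  assert (He2 : (0 < eps / 2)%R) by lra.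
  destruct (Hl (mkposreal _ He2)) as [N HN]. exists N. intros n Hn.
  pose proof (HN n Hn) as K1. pose proof (HN N (Nat.le_refl N)) as K2. simpl in K1, K2.
  apply Rabs_def2 in K1. apply Rabs_def2 in K2. lra.
Qed.

(** Dominated convergence for series: beyond some index the sum is small uniformly in
    [K], and the finitely many terms before it tend to 0. *)
Lemma tannery (T : nat -> nat -> C) (M : nat -> R) (S0 : R) (s : nat -> C) :
  (forall N, (sum_n M N <= S0)%R) ->
  (forall n K, (Cmod (T n K) <= M n)%R) ->
  (forall n eps, (0 < eps)%R ->
     exists K0, forall K, (K0 <= K)%nat -> (Cmod (T n K) < eps)%R) ->
  (forall K, Csums (fun n => T n K) (s K)) ->
  forall eps, (0 < eps)%R -> exists K0, forall K, (K0 <= K)%nat -> (Cmod (s K) < eps)%R.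
Proof.
  intros HS HM HT Hs eps He.
  assert (M0 : forall n, (0 <= M n)%R).
  { intros n. eapply Rle_trans; [apply Cmod_ge_0 | apply (HM n 0%nat)]. }
  destruct (summable_tail M S0 (eps / 3) M0 HS) as [N HN]; [lra |].
  assert (Hfin : forall m e, (0 < e)%R -> exists K0, forall K, (K0 <= K)%nat ->
            (sum_n (fun n => Cmod (T n K)) m < e)%R).
  { induction m as [|m IH]; intros e Hpos.
    - destruct (HT 0%nat e Hpos) as [K0 HK]. exists K0. intros K HKK.
      rewrite sum_O. now apply HK.
    - destruct (IH (e / 2)%R) as [K1 H1]; [lra |].
      destruct (HT (S m) (e / 2)%R) as [K2 H2]; [lra |].
      exists (max K1 K2). intros K HK. rewrite Rsum_S.
      specialize (H1 K ltac:(lia)). specialize (H2 K ltac:(lia)). lra. }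
  destruct (Hfin N (eps / 3)%R) as [K0 HK0]; [lra |].
  exists K0. intros K HK. specialize (HK0 K HK).
  apply Rle_lt_trans with (2 * (eps / 3))%R; [| lra].
  apply (Csums_Cmod_le (fun n => T n K)); [apply Hs |].
  intros m. eapply Rle_trans; [apply Cmod_Csum_le |].
  assert (Hmono : forall a, (sum_n (fun n => Cmod (T n K)) (N + a)
     <= sum_n (fun n => Cmod (T n K)) N + (sum_n M (N + a) - sum_n M N))%R).
  { induction a as [|a IH].
    - rewrite Nat.add_0_r. lra.
    - rewrite Nat.add_succ_r, !Rsum_S. specialize (HM (S (N + a)) K). lra. }
  destruct (Nat.le_gt_cases m N) as [Hle | Hgt].
  - assert (Hinc : forall a, (sum_n (fun n => Cmod (T n K)) m
       <= sum_n (fun n => Cmod (T n K)) (m + a))%R).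
    { induction a as [|a IH].
      - rewrite Nat.add_0_r. lra.
      - rewrite Nat.add_succ_r, Rsum_S. pose proof (Cmod_ge_0 (T (S (m + a)) K)). lra. }
    specialize (Hinc (N - m)%nat). replace (m + (N - m))%nat with N in Hinc by lia. lra.
  - specialize (Hmono (m - N)%nat). replace (N + (m - N))%nat with m in Hmono by lia.
    specialize (HN m ltac:(lia)). lra.
Qed.

Lemma Csums_Csum (c : nat -> nat -> C) (L : nat -> C) (K : nat) :
  (forall k, Csums (fun n => c n k) (L k)) ->
  Csums (fun n => Csum (c n) K) (Csum L K).
Proof.
  intros H. induction K as [|K IH].
  - unfold Csum at 2. rewrite sum_O. apply (Csums_ext (fun n => c n 0%nat)); [| apply H].
    intros n. unfold Csum. now rewrite sum_O.
  - rewrite Csum_S. apply (Csums_ext (fun n => Csum (c n) K + c n (S K))).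
    + intros n. now rewrite Csum_S.
    + apply Csums_plus; [exact IH | apply H].
Qed.

(** The difference between the partial sum of [col] up to [K] and [l] is the sum over
    [n] of the tails [Csum (c n) K - row n], which tend to 0 with [K] under the
    domination [2 * M n]. *)
Lemma fubini (c : nat -> nat -> C) (M : nat -> R) (S0 : R) (row col : nat -> C) (l : C) :
  (forall n N, (sum_n (fun k => Cmod (c n k)) N <= M n)%R) ->
  (forall N, (sum_n M N <= S0)%R) ->
  (forall n, Csums (c n) (row n)) -> Csums row l ->
  (forall k, Csums (fun n => c n k) (col k)) ->
  Csums col l.
Proof.
  intros Hc HS Hrow Hl Hcol. apply Csums_iff.
  apply (tannery (fun n K => Csum (c n) K - row n) (fun n => 2 * M n)%R (2 * S0)%R).
  - intros N. rewrite Rsum_scal. specialize (HS N). lra.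
  - intros n K.
    assert (H1 : (Cmod (Csum (c n) K) <= M n)%R).
    { eapply Rle_trans; [apply Cmod_Csum_le | apply Hc]. }
    assert (H2 : (Cmod (row n) <= M n)%R).
    { apply (Csums_Cmod_le (c n)); [apply Hrow |].
      intros N. eapply Rle_trans; [apply Cmod_Csum_le | apply Hc]. }
    pose proof (Cmod_triangle (Csum (c n) K) (- row n)) as H3. rewrite Cmod_opp in H3.
    unfold Cminus. lra.
  - intros n. apply Csums_iff, Hrow.
  - intros K. apply Csums_minus; [| exact Hl].
    now apply Csums_Csum.
Qed.

(** The norm of a coefficientwise limit of expansions is at most any common bound of
    their norms; this is that fact for the first [K + 1] coefficients. *)
Lemma Rsum_Cmod_lim (c : nat -> nat -> C) (col : nat -> C) (S0 : R) (K : nat) :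
  (forall k, Csums (fun n => c n k) (col k)) ->
  (forall N, (sum_n (fun k => Cmod (Csum (fun n => c n k) N)) K <= S0)%R) ->
  (sum_n (fun k => Cmod (col k)) K <= S0)%R.
Proof.
  intros Hcol HS.
  assert (Hlim : forall m e, (0 < e)%R -> exists N0, forall N, (N0 <= N)%nat ->
     (sum_n (fun k => Cmod (col k)) m
        < sum_n (fun k => Cmod (Csum (fun n => c n k) N)) m + e)%R).
  { assert (H1 : forall k e, (0 < e)%R -> exists N0, forall N, (N0 <= N)%nat ->
       (Cmod (col k) < Cmod (Csum (fun n => c n k) N) + e)%R).
    { intros k e He. destruct (proj1 (Csums_iff _ _) (Hcol k) e He) as [N0 HN].
      exists N0. intros N HNN. specialize (HN N HNN).
      pose proof (Cmod_triangle (Csum (fun n => c n k) N)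
                    (- (Csum (fun n => c n k) N - col k))) as H3.
      rewrite Cmod_opp in H3.
      match type of H3 with (Cmod ?a <= _)%R => replace a with (col k) in H3 by ring end.
      lra. }
    induction m as [|m IH]; intros e He.
    - destruct (H1 0%nat e He) as [N0 HN]. exists N0. intros N HNN.
      rewrite !sum_O. now apply HN.
    - destruct (IH (e / 2)%R) as [N1 HN1]; [lra |].
      destruct (H1 (S m) (e / 2)%R) as [N2 HN2]; [lra |].
      exists (max N1 N2). intros N HN. rewrite !Rsum_S.
      specialize (HN1 N ltac:(lia)). specialize (HN2 N ltac:(lia)). lra. }
  apply Rnot_lt_le. intros Hlt.
  destruct (Hlim K (sum_n (fun k => Cmod (col k)) K - S0)%R) as [N HN]; [lra |].
  specialize (HN N (Nat.le_refl N)). specialize (HS N). lra.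
Qed.

(** * The complex exponential series *)

Lemma Cexp_add (z w : C) : Cexp (z + w) = Cexp z * Cexp w.
Proof.
  unfold Cexp, Cmult, Cplus, Re, Im. destruct z as [a b], w as [c d]. simpl.
  rewrite exp_plus, cos_plus, sin_plus. f_equal; ring.
Qed.

Lemma Cexp_0 : Cexp 0 = 1.
Proof.
  unfold Cexp, Re, Im. simpl. rewrite exp_0, cos_0, sin_0. unfold RtoC. f_equal; ring.
Qed.

Lemma Cmod_Cexp (z : C) : Cmod (Cexp z) = exp (Re z).
Proof.
  unfold Cmod, Cexp. cbn [fst snd].
  replace ((exp (Re z) * cos (Im z)) ^ 2 + (exp (Re z) * sin (Im z)) ^ 2)%R
    with (exp (Re z) ^ 2 * (Rsqr (sin (Im z)) + Rsqr (cos (Im z))))%R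
    by (unfold Rsqr; ring).
  rewrite sin2_cos2, Rmult_1_r. apply sqrt_pow2, Rlt_le, exp_pos.
Qed.

Lemma Cexp_neq_0 (z : C) : Cexp z <> 0.
Proof.
  intros H. pose proof (Cmod_Cexp z) as K. rewrite H, Cmod_0 in K.
  pose proof (exp_pos (Re z)). lra.
Qed.

Lemma Cexp_opp (z : C) : Cexp (- z) = / Cexp z.
Proof.
  assert (H : Cexp z * Cexp (- z) = 1).
  { rewrite <- Cexp_add. replace (z + - z) with (RtoC 0) by ring. apply Cexp_0. }
  replace (Cexp (- z)) with (/ Cexp z * (Cexp z * Cexp (- z))).
  - rewrite H. ring.
  - field. apply Cexp_neq_0.
Qed.

Lemma Cexp_RtoC (x : R) : Cexp (RtoC x) = RtoC (exp x).
Proof.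
  unfold Cexp, RtoC, Re, Im. simpl. rewrite cos_0, sin_0. f_equal; ring.
Qed.

Lemma Cmod_RtoC_pos (x : R) : (0 <= x)%R -> Cmod (RtoC x) = x.
Proof. intros H. rewrite Cmod_R. now apply Rabs_pos_eq. Qed.

Definition exp_term (u : C) (k : nat) : C := u ^ k / RtoC (INR (fact k)).

Lemma RtoC_fact_neq_0 (k : nat) : RtoC (INR (fact k)) <> 0.
Proof. intros H. apply RtoC_inj in H. apply (INR_fact_neq_0 k H). Qed.

Lemma exp_term_S (u : C) (k : nat) :
  RtoC (INR (S k)) * exp_term u (S k) = u * exp_term u k.
Proof.
  unfold exp_term. rewrite fact_simpl, mult_INR, RtoC_mult. simpl (u ^ S k).
  field. split; [apply RtoC_fact_neq_0 |].
  intros H. apply RtoC_inj in H. apply (not_0_INR (S k)); [lia | exact H].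
Qed.

Lemma Cmod_exp_term (u : C) (k : nat) :
  Cmod (exp_term u k) = (Cmod u ^ k / INR (fact k))%R.
Proof.
  unfold exp_term. rewrite Cmod_div by apply RtoC_fact_neq_0.
  rewrite Cmod_pow, Cmod_RtoC_pos by apply pos_INR. reflexivity.
Qed.

(** The exponential series is obtained from the derivative along the real line of
    [exp (- s u)] times a partial sum of the series of [exp (s u)], which telescopes to
    one term.  A real-valued function is needed for the mean value theorem, hence the
    real part of the product with a fixed [w]. *)
Lemma is_derive_Re_exp_monomial (u w : C) (k : nat) (t : R) :
  is_derive (fun s : R => Re (w * (Cexp (- (RtoC s * u)) * RtoC (s ^ k)))) t
    (Re (w * (Cexp (- (RtoC t * u)) *
       (RtoC (INR k * t ^ pred k) - RtoC (t ^ k) * u))))%R.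
Proof.
  destruct u as [a b], w as [c d].
  unfold Cminus, Cexp, Cmult, Copp, RtoC, Cplus, Re, Im, Rminus. cbn [fst snd].
  auto_derive; [exact I |]. ring.
Qed.

Lemma is_derive_Re_exp_partial (u w : C) (n : nat) (t : R) :
  is_derive (fun s : R => Re (w * (Cexp (- (RtoC s * u)) *
                 Csum (fun k => RtoC (s ^ k) * exp_term u k) n))) t
    (Re (w * (Cexp (- (RtoC t * u)) * (- (RtoC (t ^ n) * (u * exp_term u n)))))).
Proof.
  induction n as [|n IH].
  - pose proof (is_derive_Re_exp_monomial u (w * exp_term u 0) 0 t) as H.
    cbn [pred] in H.
    replace (w * (Cexp (- (t * u)) * - (RtoC (t ^ 0) * (u * exp_term u 0))))
      with (w * exp_term u 0 * (Cexp (- (t * u)) * (RtoC (INR 0 * t ^ 0) - RtoC (t ^ 0) * u))).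
    + eapply is_derive_ext; [| exact H]. intros s. apply (f_equal Re).
      unfold Csum. rewrite sum_O. ring.
    + simpl (INR 0). replace (0 * t ^ 0)%R with 0%R by ring. ring.
  - pose proof (is_derive_Re_exp_monomial u (w * exp_term u (S n)) (S n) t) as H.
    cbn [pred] in H.
    pose proof (is_derive_plus _ _ _ _ _ IH H) as K.
    match type of K with is_derive _ _ ?l => set (L := l) in K end.
    replace (Re (w * (Cexp (- (t * u)) * - (RtoC (t ^ S n) * (u * exp_term u (S n)))))) with L.
    + eapply is_derive_ext; [| exact K]. intros s. cbv beta. rewrite Csum_S.
      change (plus ?x ?y) with (x + y)%R. unfold Re.
      match goal with |- (fst ?x + fst ?y)%R = fst ?z =>
        change (fst (x + y) = fst z); apply (f_equal fst); change (@eq C (x + y) z); ring end.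
    + unfold L. change (plus ?x ?y) with (x + y)%R. unfold Re.
      match goal with |- (fst ?x + fst ?y)%R = fst ?z =>
        change (fst (x + y) = fst z); apply (f_equal fst); change (@eq C (x + y) z) end.
      replace (u * exp_term u n) with (RtoC (INR (S n)) * exp_term u (S n))
        by apply exp_term_S.
      rewrite RtoC_mult. ring.
Qed.

(** With [x] the error in [exp (- u) * partial sum = 1], the mean value theorem on
    [0, 1] is applied with [w = Cconj x], which turns the increment into [|x|^2]. *)
Lemma exp_remainder (u : C) (n : nat) :
  (Cmod (Csum (exp_term u) n - Cexp u)
   <= exp (Cmod u) * exp (Cmod u) * Cmod u * (Cmod u ^ n / INR (fact n)))%R.
Proof.
  set (x := Cexp (- u) * Csum (exp_term u) n - 1).
  assert (Hx : (Cmod x <= exp (Cmod u) * Cmod u * (Cmod u ^ n / INR (fact n)))%R).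
  { set (f := fun s : R => Re (Cconj x * (Cexp (- (RtoC s * u)) *
                 Csum (fun k => RtoC (s ^ k) * exp_term u k) n))).
    set (df := fun t : R => Re (Cconj x * (Cexp (- (RtoC t * u)) *
                  (- (RtoC (t ^ n) * (u * exp_term u n)))))).
    assert (Hd : forall t, is_derive f t (df t))
      by (intros t; apply is_derive_Re_exp_partial).
    destruct (MVT_gen f 0 1 df) as [t [Ht Hf]].
    - intros t _. apply Hd.
    - intros t _. apply derivable_continuous_pt. exists (df t).
      apply is_derive_Reals, Hd.
    - rewrite Rmin_left, Rmax_right in Ht by lra.
      assert (H0 : f 0%R = Re (Cconj x)).
      { unfold f. f_equal.
        replace (- (0 * u)) with (RtoC 0) by ring. rewrite Cexp_0.
        assert (E : forall m, Csum (fun k => RtoC (0 ^ k) * exp_term u k) m = 1).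
        { induction m as [|m IHm].
          - unfold Csum. rewrite sum_O. unfold exp_term. simpl. field.
          - rewrite Csum_S, IHm. simpl. rewrite Rmult_0_l. ring. }
        rewrite E. ring. }
      assert (H1 : f 1%R = Re (Cconj x * (Cexp (- u) * Csum (exp_term u) n))).
      { unfold f. f_equal. f_equal. f_equal.
        - f_equal. ring.
        - apply Csum_ext. intros k. rewrite pow1. ring. }
      assert (H2 : (Cmod x ^ 2 = df t)%R).
      { rewrite Rminus_0_r, Rmult_1_r in Hf. rewrite <- Hf, H1, H0.
        replace (Cexp (- u) * Csum (exp_term u) n) with (x + 1) by (unfold x; ring).
        apply RtoC_inj. rewrite Cmod2_conj.
        destruct x as [p q]. unfold Cmult, Cconj, RtoC, Cplus, Re. simpl. f_equal; ring. }
      assert (H3 : (df t <= Cmod x * (exp (Cmod u) * Cmod u * (Cmod u ^ n / INR (fact n))))%R).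
      { unfold df. eapply Rle_trans; [apply Rle_abs |].
        eapply Rle_trans; [apply re_le_Cmod |].
        rewrite !Cmod_mult, Cmod_opp, !Cmod_mult, Cmod_conj, Cmod_exp_term, Cmod_Cexp.
        rewrite Cmod_RtoC_pos by (apply pow_le; lra).
        apply Rmult_le_compat_l; [apply Cmod_ge_0 |].
        assert (E1 : (exp (Re (- (t * u))) <= exp (Cmod u))%R).
        { assert (E : (Re (- (t * u)) <= Cmod u)%R).
          { eapply Rle_trans; [apply Rle_abs |].
            eapply Rle_trans; [apply re_le_Cmod |].
            rewrite Cmod_opp, Cmod_mult, Cmod_RtoC_pos by lra.
            pose proof (Cmod_ge_0 u). nra. }
          destruct E as [E | ->]; [left; now apply exp_increasing | right; reflexivity]. }
        assert (E2 : (0 <= Cmod u * (Cmod u ^ n / INR (fact n)))%R).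
        { apply Rmult_le_pos; [apply Cmod_ge_0 |]. rewrite <- Cmod_exp_term. apply Cmod_ge_0. }
        assert (E3 : (0 <= t ^ n <= 1)%R).
        { split; [apply pow_le; lra |]. rewrite <- (pow1 n). apply pow_incr; lra. }
        pose proof (exp_pos (Re (- (t * u)))) as E4.
        rewrite Rmult_assoc.
        apply Rmult_le_compat; [lra | apply Rmult_le_pos; lra | exact E1 |].
        nra. }
      pose proof (Cmod_ge_0 x). rewrite <- H2 in H3.
      destruct (Req_dec (Cmod x) 0) as [Hz | Hz].
      + rewrite Hz. rewrite Rmult_assoc. apply Rmult_le_pos; [apply Rlt_le, exp_pos |].
        apply Rmult_le_pos; [apply Cmod_ge_0 |]. rewrite <- Cmod_exp_term. apply Cmod_ge_0.
      + apply (Rmult_le_reg_l (Cmod x)); [lra |]. simpl in H3. lra. }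
  replace (Csum (exp_term u) n - Cexp u) with (Cexp u * x).
  - rewrite Cmod_mult, Cmod_Cexp, !Rmult_assoc.
    apply Rmult_le_compat; [apply Rlt_le, exp_pos | apply Cmod_ge_0 | | ].
    + assert (E : (Re u <= Cmod u)%R)
        by (eapply Rle_trans; [apply Rle_abs | apply re_le_Cmod]).
      destruct E as [E | ->]; [left; now apply exp_increasing | right; reflexivity].
    + rewrite Rmult_assoc in Hx. exact Hx.
  - unfold x. rewrite Cexp_opp. field. apply Cexp_neq_0.
Qed.

Lemma Cexp_series (u : C) : Csums (exp_term u) (Cexp u).
Proof.
  apply Csums_iff. intros eps He.
  set (K := (exp (Cmod u) * exp (Cmod u) * Cmod u)%R).
  assert (HK : (0 <= K)%R).
  { unfold K. pose proof (exp_pos (Cmod u)). pose proof (Cmod_ge_0 u).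
    apply Rmult_le_pos; nra. }
  assert (He' : (0 < eps / (K + 1))%R) by (apply Rdiv_lt_0_compat; lra).
  destruct (cv_speed_pow_fact (Cmod u) (eps / (K + 1))%R He') as [N HN].
  exists N. intros n Hn. specialize (HN n Hn).
  eapply Rle_lt_trans; [apply exp_remainder |]. fold K.
  unfold Rdist in HN. rewrite Rminus_0_r in HN.
  assert (Hp : (0 <= Cmod u ^ n / INR (fact n))%R)
    by (rewrite <- Cmod_exp_term; apply Cmod_ge_0).
  rewrite Rabs_pos_eq in HN by exact Hp.
  apply Rle_lt_trans with ((K + 1) * (Cmod u ^ n / INR (fact n)))%R; [nra |].
  apply (Rmult_lt_compat_l (K + 1)) in HN; [| lra].
  replace ((K + 1) * (eps / (K + 1)))%R with eps in HN by (field; lra). exact HN.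
Qed.

(** * Dominated power series expansions *)

(** The bound [M] on the norm [sum |a_k| r^k] is part of the predicate: it is what makes
    infinite sums of expansions possible. *)
Definition expansion (f : C -> C) (z0 : C) (r M : R) (a : nat -> C) : Prop :=
  (0 < r)%R /\
  (forall z, (Cmod (z - z0) <= r)%R -> Csums (fun k => a k * (z - z0) ^ k) (f z)) /\
  (forall N, (sum_n (fun k => Cmod (a k) * r ^ k) N <= M)%R).

Definition expands (f : C -> C) (z0 : C) (r M : R) : Prop :=
  exists a, expansion f z0 r M a.

Lemma pow_n_Cpow (u : C) (k : nat) : @pow_n C_Ring u k = u ^ k.
Proof.
  induction k as [|k IH]; [reflexivity |]. simpl. rewrite IH. reflexivity.
Qed.

Lemma Csums_terms_bounded (u : nat -> C) (l : C) :
  Csums u l -> exists B, forall n, (Cmod (u n) <= B)%R.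
Proof.
  intros H. destruct (proj1 (Csums_iff u l) H 1%R) as [N HN]; [lra |].
  assert (Hfin : forall m, exists B, forall n, (n <= m)%nat -> (Cmod (u n) <= B)%R).
  { induction m as [|m [B HB]].
    - exists (Cmod (u 0%nat)). intros n Hn. replace n with 0%nat by lia. apply Rle_refl.
    - exists (Rmax B (Cmod (u (S m)))). intros n Hn.
      destruct (Nat.eq_dec n (S m)) as [-> | Hne]; [apply Rmax_r |].
      eapply Rle_trans; [apply HB; lia | apply Rmax_l]. }
  destruct (Hfin N) as [B HB]. exists (Rmax B 2). intros n.
  destruct (Nat.le_gt_cases n N) as [Hle | Hgt].
  - eapply Rle_trans; [now apply HB | apply Rmax_l].
  - eapply Rle_trans; [| apply Rmax_r]. destruct n as [|n]; [lia |].
    pose proof (HN n ltac:(lia)) as K1. pose proof (HN (S n) ltac:(lia)) as K2.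
    rewrite Csum_S in K2.
    pose proof (Cmod_triangle (Csum u n + u (S n) - l) (- (Csum u n - l))) as K3.
    rewrite Cmod_opp in K3.
    replace (Csum u n + u (S n) - l + - (Csum u n - l)) with (u (S n)) in K3 by ring. lra.
Qed.

Lemma geometric_sum_le (q : R) (n : nat) :
  (0 <= q < 1)%R -> (sum_n (fun k => (q ^ k)%R) n <= / (1 - q))%R.
Proof.
  intros Hq. rewrite sum_n_Reals, tech3 by lra.
  unfold Rdiv. rewrite <- (Rmult_1_l (/ (1 - q))) at 2.
  apply Rmult_le_compat_r; [apply Rlt_le, Rinv_0_lt_compat; lra |].
  assert (0 <= q ^ S n)%R by (apply pow_le; lra). lra.
Qed.

(** The terms are bounded at a point at distance [3 r / 4] of the centre, so the series
    is dominated by a geometric one at [r / 2]. *)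
Lemma expands_of_analytic (f : C -> C) (z0 : C) :
  analytic_at f z0 -> exists r M, expands f z0 r M.
Proof.
  intros [a [[r Hr] H]]. simpl in H.
  assert (H' : forall z, (Cmod (z - z0) < r)%R -> Csums (fun k => a k * (z - z0) ^ k) (f z)).
  { intros z Hz. apply (Csums_ext (fun k => scal (@pow_n C_Ring (z - z0) k) (a k))).
    - intros k. rewrite pow_n_Cpow. change (scal ?x ?y) with (x * y). apply Cmult_comm.
    - exact (H z Hz). }
  set (rho := (3 / 4 * r)%R).
  assert (Hrho : (Cmod (z0 + RtoC rho - z0) < r)%R).
  { replace (z0 + RtoC rho - z0) with (RtoC rho) by ring.
    rewrite Cmod_RtoC_pos; unfold rho; lra. }
  destruct (Csums_terms_bounded _ _ (H' _ Hrho)) as [B HB].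
  exists (r / 2)%R, (B * / (1 - 2 / 3))%R, a. split; [lra | split].
  - intros z Hz. apply H'. lra.
  - intros N. apply Rle_trans with (sum_n (fun k => (B * (2 / 3) ^ k)%R) N).
    + apply Rsum_le. intros k.
      assert (E : (r / 2 = rho * (2 / 3))%R) by (unfold rho; field).
      rewrite E, Rpow_mult_distr, <- Rmult_assoc. apply Rmult_le_compat_r; [apply pow_le; lra |].
      specialize (HB k). rewrite Cmod_mult, Cmod_pow in HB.
      replace (z0 + RtoC rho - z0) with (RtoC rho) in HB by ring.
      rewrite Cmod_RtoC_pos in HB by (unfold rho; lra). exact HB.
    + rewrite Rsum_scal. apply Rmult_le_compat_l.
      * eapply Rle_trans; [apply Cmod_ge_0 | apply (HB 0%nat)].
      * apply geometric_sum_le; lra.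
Qed.

Lemma analytic_of_expands (f : C -> C) (z0 : C) (r M : R) :
  expands f z0 r M -> analytic_at f z0.
Proof.
  intros [a [Hr [H _]]]. exists a, (mkposreal r Hr). intros z Hz. simpl in Hz.
  change (Csums (fun k => scal (@pow_n C_Ring (z - z0) k) (a k)) (f z)).
  apply (Csums_ext (fun k => a k * (z - z0) ^ k)); [| apply H; lra].
  intros k. transitivity ((z - z0) ^ k * a k); [apply Cmult_comm |].
  apply (f_equal (fun x : C => x * a k)). symmetry. apply pow_n_Cpow.
Qed.

(** For [|z - z0| <= r] each term is at most [(|z - z0| / r)^k] times its value at
    radius [r].  The case [n = 0] gives continuity, [n = 1] the derivative, and the
    general case the vanishing of the coefficients in the identity theorem. *)
Lemma expansion_remainder (f : C -> C) (z0 : C) (r M : R) (a : nat -> C) (z : C) (n : nat) :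
  expansion f z0 r M a -> (Cmod (z - z0) <= r)%R ->
  (Cmod (f z - Csum (fun k => a k * (z - z0) ^ k)%C n) <= (Cmod (z - z0) / r) ^ S n * M)%R.
Proof.
  intros [Hr [H HM]] Hz. specialize (H z Hz).
  set (u := fun k => a k * (z - z0) ^ k). fold u in H.
  set (v := fun k => (Cmod (a k) * r ^ k)%R). fold v in HM.
  set (q := (Cmod (z - z0) / r)%R).
  assert (Hq : (0 <= q <= 1)%R).
  { unfold q. split.
    - apply Rmult_le_pos; [apply Cmod_ge_0 | apply Rlt_le, Rinv_0_lt_compat, Hr].
    - apply (Rmult_le_reg_r r); [exact Hr |]. unfold Rdiv.
      rewrite Rmult_assoc, Rinv_l by lra. lra. }
  assert (Hv : forall k, (0 <= v k)%R).
  { intros k. unfold v. apply Rmult_le_pos; [apply Cmod_ge_0 | apply pow_le; lra]. }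
  assert (Hu : forall k, Cmod (u k) = (q ^ k * v k)%R).
  { intros k. unfold u, v, q. rewrite Cmod_mult, Cmod_pow.
    replace (Cmod (z - z0)) with (Cmod (z - z0) / r * r)%R at 1 by (field; lra).
    rewrite Rpow_mult_distr. ring. }
  assert (Hqn : (0 <= q ^ S n)%R) by (apply pow_le; lra).
  assert (Hdiff : forall m, (Cmod (Csum u (n + m) - Csum u n)
                   <= q ^ S n * (sum_n v (n + m) - sum_n v n))%R).
  { induction m as [|m IH].
    - rewrite Nat.add_0_r. replace (Csum u n - Csum u n) with (RtoC 0) by ring.
      rewrite Cmod_0. lra.
    - rewrite Nat.add_succ_r, Csum_S, Rsum_S.
      replace (Csum u (n + m) + u (S (n + m)) - Csum u n)
        with (Csum u (n + m) - Csum u n + u (S (n + m))) by ring.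
      eapply Rle_trans; [apply Cmod_triangle |]. rewrite Hu.
      assert (E : (q ^ S (n + m) <= q ^ S n)%R).
      { replace (S (n + m)) with (S n + m)%nat by lia. rewrite pow_add.
        assert (q ^ m <= 1)%R by (rewrite <- (pow1 m); apply pow_incr; lra). nra. }
      specialize (Hv (S (n + m))). nra. }
  apply Rnot_lt_le. intros Hlt.
  destruct (proj1 (Csums_iff u (f z)) H
    (Cmod (f z - Csum u n) - q ^ S n * M)%R) as [N HN]; [lra |].
  specialize (HN (n + N)%nat ltac:(lia)). specialize (Hdiff N).
  pose proof (HM (n + N)%nat) as HM1. pose proof (Rsum_nonneg v n Hv) as HM2.
  pose proof (Cmod_triangle (Csum u (n + N) - Csum u n) (- (Csum u (n + N) - f z))) as K.
  rewrite Cmod_opp in K.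
  replace (Csum u (n + N) - Csum u n + - (Csum u (n + N) - f z))
    with (f z - Csum u n) in K by ring.
  assert (q ^ S n * (sum_n v (n + N) - sum_n v n) <= q ^ S n * M)%R
    by (apply Rmult_le_compat_l; lra).
  lra.
Qed.

Lemma expansion_bound_nonneg (f : C -> C) (z0 : C) (r M : R) (a : nat -> C) :
  expansion f z0 r M a -> (0 <= M)%R.
Proof.
  intros [Hr [_ HM]]. eapply Rle_trans; [| apply (HM 0%nat)].
  apply Rsum_nonneg. intros k. apply Rmult_le_pos; [apply Cmod_ge_0 | apply pow_le; lra].
Qed.

Lemma expansion_center (f : C -> C) (z0 : C) (r M : R) (a : nat -> C) :
  expansion f z0 r M a -> f z0 = a 0%nat.
Proof.
  intros H. assert (Hz : (Cmod (z0 - z0) <= r)%R).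
  { replace (z0 - z0) with (RtoC 0) by ring. rewrite Cmod_0. destruct H; lra. }
  pose proof (expansion_remainder f z0 r M a z0 0 H Hz) as K.
  unfold Csum in K. rewrite sum_O in K.
  replace (z0 - z0) with (RtoC 0) in K by ring. rewrite Cmod_0 in K.
  replace ((0 / r) ^ 1 * M)%R with 0%R in K by (destruct H; field; lra).
  replace (f z0 - a 0%nat * 0 ^ 0) with (f z0 - a 0%nat) in K by (simpl; ring).
  pose proof (Cmod_ge_0 (f z0 - a 0%nat)).
  assert (E : f z0 - a 0%nat = 0) by (apply Cmod_eq_0; lra).
  replace (f z0) with (f z0 - a 0%nat + a 0%nat) by ring. rewrite E. ring.
Qed.

Lemma expansion_deriv (f : C -> C) (z0 : C) (r M : R) (a : nat -> C) :
  expansion f z0 r M a -> Cderiv f z0 (a 1%nat).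
Proof.
  intros H. apply Cderiv_iff. intros eps He.
  pose proof (expansion_bound_nonneg _ _ _ _ _ H) as HM.
  assert (Hr : (0 < r)%R) by apply H.
  assert (Hr2 : (0 < r ^ 2)%R) by (apply pow_lt, Hr).
  exists (Rmin r (eps * r ^ 2 / (M + 1)))%R. split.
  - apply Rmin_pos; [exact Hr |]. apply Rdiv_lt_0_compat; [nra | lra].
  - intros y Hy.
    assert (Hy1 : (Cmod (y - z0) < r)%R) by (eapply Rlt_le_trans; [exact Hy | apply Rmin_l]).
    assert (Hy2 : (Cmod (y - z0) < eps * r ^ 2 / (M + 1))%R)
      by (eapply Rlt_le_trans; [exact Hy | apply Rmin_r]).
    pose proof (expansion_remainder f z0 r M a y 1 H ltac:(lra)) as K.
    rewrite Csum_S in K. unfold Csum in K. rewrite sum_O in K.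
    rewrite (expansion_center f z0 r M a H).
    replace (f y - a 0%nat - (y - z0) * a 1%nat)
      with (f y - (a 0%nat * (y - z0) ^ 0 + a 1%nat * (y - z0) ^ 1)) by (simpl; ring).
    eapply Rle_trans; [exact K |].
    pose proof (Cmod_ge_0 (y - z0)) as Hp. set (d := Cmod (y - z0)) in *.
    assert (K2 : (d * (M + 1) <= eps * r ^ 2)%R).
    { apply Rlt_le in Hy2. apply (Rmult_le_compat_r (M + 1)) in Hy2; [| lra].
      replace (eps * r ^ 2 / (M + 1) * (M + 1))%R with (eps * r ^ 2)%R in Hy2 by (field; lra).
      exact Hy2. }
    replace ((d / r) ^ 2 * M)%R with (d * (d * M) / r ^ 2)%R by (field; lra).
    apply (Rmult_le_reg_r (r ^ 2)); [exact Hr2 |].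
    replace (d * (d * M) / r ^ 2 * r ^ 2)%R with (d * (d * M))%R by (field; lra). nra.
Qed.

Definition Ccontinuous (f : C -> C) (z0 : C) : Prop :=
  forall eps, (0 < eps)%R -> exists d, (0 < d)%R /\
    forall z, (Cmod (z - z0) < d)%R -> (Cmod (f z - f z0) < eps)%R.

Lemma expands_continuous (f : C -> C) (z0 : C) (r M : R) :
  expands f z0 r M -> Ccontinuous f z0.
Proof.
  intros [a H] eps He.
  pose proof (expansion_bound_nonneg _ _ _ _ _ H) as HM.
  assert (Hr : (0 < r)%R) by apply H.
  exists (Rmin r (eps * r / (M + 1)))%R. split.
  - apply Rmin_pos; [exact Hr |]. apply Rdiv_lt_0_compat; [nra | lra].
  - intros y Hy.
    assert (Hy1 : (Cmod (y - z0) < r)%R) by (eapply Rlt_le_trans; [exact Hy | apply Rmin_l]).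
    assert (Hy2 : (Cmod (y - z0) < eps * r / (M + 1))%R)
      by (eapply Rlt_le_trans; [exact Hy | apply Rmin_r]).
    pose proof (expansion_remainder f z0 r M a y 0 H ltac:(lra)) as K.
    unfold Csum in K. rewrite sum_O in K.
    rewrite (expansion_center f z0 r M a H).
    replace (a 0%nat * (y - z0) ^ 0) with (a 0%nat) in K by (simpl; ring).
    eapply Rle_lt_trans; [exact K |].
    pose proof (Cmod_ge_0 (y - z0)) as Hp. set (d := Cmod (y - z0)) in *.
    apply (Rmult_lt_compat_r (M + 1)) in Hy2; [| lra].
    replace (eps * r / (M + 1) * (M + 1))%R with (eps * r)%R in Hy2 by (field; lra).
    apply (Rmult_lt_reg_r r); [exact Hr |].
    replace ((d / r) ^ 1 * M * r)%R with (d * M)%R by (field; lra). nra.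
Qed.

Lemma Cderiv_unique (f : C -> C) (z l1 l2 : C) : Cderiv f z l1 -> Cderiv f z l2 -> l1 = l2.
Proof.
  intros H1 H2. apply is_C_derive_unique in H1. apply is_C_derive_unique in H2. congruence.
Qed.

Lemma expands_ext (f g : C -> C) (z0 : C) (r M : R) :
  (forall z, (Cmod (z - z0) <= r)%R -> f z = g z) -> expands f z0 r M -> expands g z0 r M.
Proof.
  intros E [a [Hr [H HM]]]. exists a. split; [exact Hr | split; [| exact HM]].
  intros z Hz. rewrite <- E by exact Hz. now apply H.
Qed.

Lemma expands_le (f : C -> C) (z0 : C) (r M M' : R) :
  (M <= M')%R -> expands f z0 r M -> expands f z0 r M'.
Proof.
  intros E [a [Hr [H HM]]]. exists a. split; [exact Hr | split; [exact H |]].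
  intros N. eapply Rle_trans; [apply HM | exact E].
Qed.

Lemma expands_restrict (f : C -> C) (z0 : C) (r r' M : R) :
  (0 < r' <= r)%R -> expands f z0 r M -> expands f z0 r' M.
Proof.
  intros E [a [Hr [H HM]]]. exists a. split; [lra | split].
  - intros z Hz. apply H. lra.
  - intros N. eapply Rle_trans; [| apply (HM N)]. apply Rsum_le. intros k.
    apply Rmult_le_compat_l; [apply Cmod_ge_0 | apply pow_incr; lra].
Qed.

Lemma expands_plus (f g : C -> C) (z0 : C) (r M N : R) :
  expands f z0 r M -> expands g z0 r N -> expands (fun z => f z + g z) z0 r (M + N)%R.
Proof.
  intros [a [Hr [Ha HM]]] [b [_ [Hb HN]]]. exists (fun k => a k + b k).
  split; [exact Hr | split].
  - intros z Hz.
    apply (Csums_ext (fun k => a k * (z - z0) ^ k + b k * (z - z0) ^ k)); [intros; ring |].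
    apply Csums_plus; auto.
  - intros n. specialize (HM n). specialize (HN n).
    apply Rle_trans with (sum_n (fun k => (Cmod (a k) * r ^ k + Cmod (b k) * r ^ k)%R) n).
    + apply Rsum_le. intros k. pose proof (Cmod_triangle (a k) (b k)).
      assert (0 <= r ^ k)%R by (apply pow_le; lra). nra.
    + pose proof (sum_n_plus (G := R_AbelianMonoid) (fun k => (Cmod (a k) * r ^ k)%R)
        (fun k => (Cmod (b k) * r ^ k)%R) n) as E.
      change (sum_n (fun k => (Cmod (a k) * r ^ k + Cmod (b k) * r ^ k)%R) n
        = (sum_n (fun k => (Cmod (a k) * r ^ k)%R) n
           + sum_n (fun k => (Cmod (b k) * r ^ k)%R) n)%R) in E.
      rewrite E. lra.
Qed.

Lemma expands_scal (c : C) (f : C -> C) (z0 : C) (r M : R) :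
  expands f z0 r M -> expands (fun z => c * f z) z0 r (Cmod c * M)%R.
Proof.
  intros [a [Hr [Ha HM]]]. exists (fun k => c * a k).
  split; [exact Hr | split].
  - intros z Hz.
    apply (Csums_ext (fun k => c * (a k * (z - z0) ^ k))); [intros; ring |].
    apply Csums_scal; auto.
  - intros n. specialize (HM n).
    rewrite (Rsum_ext _ (fun k => (Cmod c * (Cmod (a k) * r ^ k))%R))
      by (intros; rewrite Cmod_mult; ring).
    rewrite Rsum_scal. apply Rmult_le_compat_l; [apply Cmod_ge_0 | exact HM].
Qed.

Lemma expands_const (c z0 : C) (r : R) : (0 < r)%R -> expands (fun _ => c) z0 r (Cmod c).
Proof.
  intros Hr. exists (fun k => match k with O => c | S _ => RtoC 0 end).
  split; [exact Hr | split].
  - intros z _.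
    assert (K : Csums (fun k => match k with O => c | S _ => RtoC 0 end * (z - z0) ^ k)
                  (c * (z - z0) ^ 0 + 0)).
    { apply (Csums_cons (fun k => match k with O => c | S _ => RtoC 0 end * (z - z0) ^ k)).
      apply (Csums_ext (fun _ => RtoC 0)); [intros; ring | apply Csums_zero]. }
    replace (c * (z - z0) ^ 0 + 0) with c in K by (simpl; ring). exact K.
  - induction N as [|N IH].
    + rewrite sum_O. simpl. lra.
    + rewrite Rsum_S, Cmod_0. lra.
Qed.

Lemma expands_shift (f : C -> C) (z0 : C) (r M : R) :
  expands f z0 r M -> expands (fun z => (z - z0) * f z) z0 r (r * M)%R.
Proof.
  intros [a [Hr [H HM]]]. exists (fun k => match k with O => RtoC 0 | S j => a j end).
  split; [exact Hr | split].
  - intros z Hz.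
    replace ((z - z0) * f z) with (0 * (z - z0) ^ 0 + (z - z0) * f z) by (simpl; ring).
    apply (Csums_cons (fun k => match k with O => RtoC 0 | S j => a j end * (z - z0) ^ k)).
    apply (Csums_ext (fun k => (z - z0) * (a k * (z - z0) ^ k))); [intros; simpl; ring |].
    now apply Csums_scal, H.
  - assert (M0 : (0 <= M)%R) by (eapply expansion_bound_nonneg; split; [exact Hr | split; eauto]).
    intros N. apply Rle_trans with (r * match N with O => 0 | S m =>
       sum_n (fun k => (Cmod (a k) * r ^ k)%R) m end)%R.
    + induction N as [|N IH].
      * rewrite sum_O, Cmod_0. lra.
      * rewrite Rsum_S. destruct N as [|N].
        -- rewrite !sum_O. rewrite Cmod_0. simpl. lra.
        -- rewrite (Rsum_S (fun k => (Cmod (a k) * r ^ k)%R) N). simpl pow in *. nra.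
    + apply Rmult_le_compat_l; [lra |]. destruct N; [exact M0 | apply HM].
Qed.

Lemma expands_shift_pow (f : C -> C) (z0 : C) (r M : R) (n : nat) :
  expands f z0 r M -> expands (fun z => (z - z0) ^ n * f z) z0 r (r ^ n * M)%R.
Proof.
  intros H. induction n as [|n IH].
  - rewrite Rmult_1_l. apply (expands_ext f); [intros; simpl; ring | exact H].
  - replace (r ^ S n * M)%R with (r * (r ^ n * M))%R by (simpl; ring).
    apply (expands_ext (fun z => (z - z0) * ((z - z0) ^ n * f z))); [intros; simpl; ring |].
    now apply expands_shift.
Qed.

(** The total real operator [Series] on both components: a total function, so that sums of
    functions can be defined before their convergence is known. *)
Definition CSeries (u : nat -> C) : C :=
  (Series (fun n => Re (u n)), Series (fun n => Im (u n))).

Lemma CSeries_correct (u : nat -> C) (l : C) : Csums u l -> CSeries u = l.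
Proof.
  intros H. assert (Hcomp : forall n, Csum u n = (sum_n (fun k => Re (u k)) n,
                                       sum_n (fun k => Im (u k)) n)).
  { induction n as [|n IH].
    - unfold Csum. rewrite !sum_O. now destruct (u 0%nat).
    - rewrite Csum_S, !Rsum_S, IH. now destruct (u (S n)). }
  pose proof (proj1 (Csums_iff u l) H) as K.
  destruct l as [p q]. unfold CSeries. f_equal.
  - apply is_series_unique. change (is_lim_seq (sum_n (fun n => Re (u n))) p).
    apply is_lim_seq_spec. intros eps.
    destruct (K eps (cond_pos eps)) as [N HN]. exists N. intros n Hn.
    specialize (HN n Hn). eapply Rle_lt_trans; [| exact HN].
    rewrite Hcomp. eapply Rle_trans; [| apply Rmax_Cmod]. eapply Rle_trans; [| apply Rmax_l].
    apply Rle_refl.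
  - apply is_series_unique. change (is_lim_seq (sum_n (fun n => Im (u n))) q).
    apply is_lim_seq_spec. intros eps.
    destruct (K eps (cond_pos eps)) as [N HN]. exists N. intros n Hn.
    specialize (HN n Hn). eapply Rle_lt_trans; [| exact HN].
    rewrite Hcomp. eapply Rle_trans; [| apply Rmax_Cmod]. eapply Rle_trans; [| apply Rmax_r].
    apply Rle_refl.
Qed.

(** Weierstrass theorem for expansions.  The coefficients of the sum are the sums of the
    coefficients, by exchange of the two summations; the second part reads this on the
    coefficient of degree one. *)
Lemma expands_series (f : nat -> C -> C) (F : C -> C) (z0 : C) (r : R) (M : nat -> R) (S0 : R) :
  (forall n, expands (f n) z0 r (M n)) ->
  (forall N, (sum_n M N <= S0)%R) ->
  (forall z, (Cmod (z - z0) <= r)%R -> Csums (fun n => f n z) (F z)) ->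
  expands F z0 r S0 /\
  (forall d, (forall n, Cderiv (f n) z0 (d n)) ->
     exists D, Csums d D /\ Cderiv F z0 D).
Proof.
  intros Hf HS HF.
  destruct (functional_choice _ Hf) as [a Ha].
  assert (Hr : (0 < r)%R) by apply (Ha 0%nat).
  assert (Hcoef : forall n k, (Cmod (a n k) * r ^ k <= M n)%R).
  { intros n k. apply (Rsum_term_le (fun k => Cmod (a n k) * r ^ k)%R).
    - intros j. apply Rmult_le_pos; [apply Cmod_ge_0 | apply pow_le; lra].
    - apply (Ha n). }
  assert (Hex : forall k, exists A, Csums (fun n => a n k) A).
  { intros k. apply (Csums_abs _ (/ r ^ k * S0)%R). intros N.
    assert (Hp : (0 < r ^ k)%R) by (apply pow_lt, Hr).
    apply Rle_trans with (sum_n (fun n => (/ r ^ k * M n)%R) N).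
    - apply Rsum_le. intros n. specialize (Hcoef n k).
      apply (Rmult_le_reg_l (r ^ k)); [exact Hp |].
      rewrite <- Rmult_assoc, Rinv_r by lra. lra.
    - rewrite Rsum_scal. apply Rmult_le_compat_l; [apply Rlt_le, Rinv_0_lt_compat, Hp |].
      apply HS. }
  set (A := fun k => CSeries (fun n => a n k)).
  assert (HA : forall k, Csums (fun n => a n k) (A k)).
  { intros k. destruct (Hex k) as [l Hl]. unfold A. now rewrite (CSeries_correct _ l Hl). }
  assert (HE : expansion F z0 r S0 A).
  { split; [exact Hr | split].
    - intros z Hz.
      apply (fubini (fun n k => a n k * (z - z0) ^ k) M S0 (fun n => f n z)).
      + intros n N. eapply Rle_trans; [| apply (Ha n)]. apply Rsum_le. intros k.
        rewrite Cmod_mult, Cmod_pow. apply Rmult_le_compat_l; [apply Cmod_ge_0 |].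
        apply pow_incr. split; [apply Cmod_ge_0 | exact Hz].
      + exact HS.
      + intros n. now apply (Ha n).
      + now apply HF.
      + intros k. rewrite Cmult_comm.
        apply (Csums_ext (fun n => (z - z0) ^ k * a n k)); [intros; ring |].
        now apply Csums_scal.
    - intros K.
      rewrite (Rsum_ext _ (fun k => Cmod (RtoC (r ^ k) * A k))).
      2:{ intros k. rewrite Cmod_mult, Cmod_RtoC_pos by (apply pow_le; lra). ring. }
      apply (Rsum_Cmod_lim (fun n k => RtoC (r ^ k) * a n k)).
      + intros k. now apply Csums_scal.
      + intros N.
        apply Rle_trans with (sum_n (fun k => sum_n (fun n => (Cmod (a n k) * r ^ k)%R) N) K).
        * apply Rsum_le. intros k. eapply Rle_trans; [apply Cmod_Csum_le |].
          apply Rsum_le. intros n. rewrite Cmod_mult, Cmod_RtoC_pos by (apply pow_le; lra). lra.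
        * rewrite (sum_n_switch (G := R_AbelianMonoid) (fun k n => (Cmod (a n k) * r ^ k)%R)).
          eapply Rle_trans; [| apply (HS N)]. apply Rsum_le. intros n. apply (Ha n). }
  split; [now exists A |].
  intros d Hd. exists (A 1%nat). split.
  - apply (Csums_ext (fun n => a n 1%nat)); [| apply HA].
    intros n. apply (Cderiv_unique (f n) z0); [| apply Hd].
    apply (expansion_deriv (f n) z0 r (M n)), Ha.
  - apply (expansion_deriv F z0 r S0), HE.
Qed.

(** The product is the series of the functions [a_n (z - z0)^n g z], so no Cauchy
    product is needed. *)
Lemma expands_mult (f g : C -> C) (z0 : C) (r M N : R) :
  expands f z0 r M -> expands g z0 r N -> expands (fun z => f z * g z) z0 r (M * N)%R.
Proof.
  intros [a [Hr [Ha HM]]] Hg.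
  assert (HN : (0 <= N)%R) by (destruct Hg as [b Hb]; eapply expansion_bound_nonneg, Hb).
  apply (expands_series (fun n z => a n * ((z - z0) ^ n * g z)) _ z0 r
           (fun n => Cmod (a n) * (r ^ n * N))%R).
  - intros n. now apply expands_scal, expands_shift_pow.
  - intros K. rewrite (Rsum_ext _ (fun n => (N * (Cmod (a n) * r ^ n))%R)) by (intros; ring).
    rewrite Rsum_scal, Rmult_comm. apply Rmult_le_compat_r; [exact HN | apply HM].
  - intros z Hz. rewrite Cmult_comm.
    apply (Csums_ext (fun n => g z * (a n * (z - z0) ^ n))); [intros; ring |].
    now apply Csums_scal, Ha.
Qed.

Lemma expands_pow (f : C -> C) (z0 : C) (r M : R) (n : nat) :
  expands f z0 r M -> expands (fun z => f z ^ n) z0 r (M ^ n)%R.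
Proof.
  intros H. assert (Hr : (0 < r)%R) by (destruct H as [a Ha]; apply Ha).
  induction n as [|n IH].
  - apply (expands_le _ _ _ (Cmod 1)); [rewrite Cmod_1; simpl; lra | exact (expands_const 1 z0 r Hr)].
  - simpl. now apply expands_mult.
Qed.

Lemma expands_id (z0 : C) (r : R) : (0 < r)%R -> expands (fun z => z) z0 r (Cmod z0 + r)%R.
Proof.
  intros Hr. apply (expands_ext (fun z => z0 + (z - z0) * 1)); [intros; ring |].
  apply expands_plus; [now apply expands_const |].
  apply (expands_le _ _ _ (r * Cmod 1)%R); [rewrite Cmod_1; lra |].
  now apply expands_shift, expands_const.
Qed.

Lemma exp_partial_le (x : R) (n : nat) :
  (0 <= x)%R -> (sum_n (fun k => x ^ k / INR (fact k))%R n <= exp x)%R.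
Proof.
  intros Hx. apply (is_lim_seq_incr_compare
    (sum_n (fun k => x ^ k / INR (fact k))%R)).
  - pose proof (is_exp_Reals x) as H. apply is_pseries_R in H.
    eapply is_lim_seq_ext; [| exact H]. intros m. apply Rsum_ext. intros k.
    unfold Rdiv. ring.
  - intros m. rewrite Rsum_S. assert (0 <= x ^ S m / INR (fact (S m)))%R; [| lra].
    apply Rmult_le_pos; [now apply pow_le |]. apply Rlt_le, Rinv_0_lt_compat, INR_fact_lt_0.
Qed.

Lemma expansion_exp (c : R) (z0 : C) (r : R) : (0 < r)%R ->
  expansion (fun z => Cexp (RtoC c * z)) z0 r (exp (c * Re z0) * exp (Rabs c * r))%R
    (fun k => Cexp (RtoC c * z0) * exp_term (RtoC c) k).
Proof.
  intros Hr. split; [exact Hr | split].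
  - intros z _. replace (RtoC c * z) with (RtoC c * z0 + RtoC c * (z - z0)) by ring.
    rewrite Cexp_add.
    apply (Csums_ext (fun k => Cexp (RtoC c * z0) * exp_term (RtoC c * (z - z0)) k)).
    + intros k. unfold exp_term. rewrite Cpow_mult_l. unfold Cdiv. ring.
    + apply Csums_scal, Cexp_series.
  - intros N.
    rewrite (Rsum_ext _ (fun k => (exp (c * Re z0) * ((Rabs c * r) ^ k / INR (fact k)))%R)).
    + rewrite Rsum_scal. apply Rmult_le_compat_l; [apply Rlt_le, exp_pos |].
      apply exp_partial_le. apply Rmult_le_pos; [apply Rabs_pos | lra].
    + intros k. rewrite Cmod_mult, Cmod_Cexp, Cmod_exp_term, Cmod_R, Rpow_mult_distr.
      replace (Re (RtoC c * z0)) with (c * Re z0)%R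
        by (destruct z0; unfold Re, Cmult, RtoC; simpl; ring).
      unfold Rdiv. ring.
Qed.

Lemma Cderiv_exp (c : R) (z0 : C) :
  Cderiv (fun z => Cexp (RtoC c * z)) z0 (RtoC c * Cexp (RtoC c * z0)).
Proof.
  pose proof (expansion_deriv _ _ _ _ _ (expansion_exp c z0 1 Rlt_0_1)) as H.
  cbv beta in H.
  replace (Cexp (RtoC c * z0) * exp_term (RtoC c) 1) with (RtoC c * Cexp (RtoC c * z0)) in H.
  - exact H.
  - unfold exp_term. simpl. field.
Qed.

Lemma expands_common (f g : C -> C) (z0 : C) :
  analytic_at f z0 -> analytic_at g z0 ->
  exists r M N, expands f z0 r M /\ expands g z0 r N.
Proof.
  intros Hf Hg.
  destruct (expands_of_analytic f z0 Hf) as [r1 [M HM]].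
  destruct (expands_of_analytic g z0 Hg) as [r2 [N HN]].
  assert (H1 : (0 < r1)%R) by (destruct HM as [a Ha]; apply Ha).
  assert (H2 : (0 < r2)%R) by (destruct HN as [a Ha]; apply Ha).
  exists (Rmin r1 r2), M, N. split.
  - apply (expands_restrict _ _ r1); [| exact HM]. split; [now apply Rmin_pos | apply Rmin_l].
  - apply (expands_restrict _ _ r2); [| exact HN]. split; [now apply Rmin_pos | apply Rmin_r].
Qed.

Lemma analytic_plus (f g : C -> C) (z0 : C) :
  analytic_at f z0 -> analytic_at g z0 -> analytic_at (fun z => f z + g z) z0.
Proof.
  intros Hf Hg. destruct (expands_common f g z0 Hf Hg) as (r & M & N & H1 & H2).
  eapply analytic_of_expands, expands_plus; eassumption.
Qed.

Lemma analytic_mult (f g : C -> C) (z0 : C) :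
  analytic_at f z0 -> analytic_at g z0 -> analytic_at (fun z => f z * g z) z0.
Proof.
  intros Hf Hg. destruct (expands_common f g z0 Hf Hg) as (r & M & N & H1 & H2).
  eapply analytic_of_expands, expands_mult; eassumption.
Qed.

Lemma analytic_const (c z0 : C) : analytic_at (fun _ => c) z0.
Proof. eapply analytic_of_expands, (expands_const c z0 1), Rlt_0_1. Qed.

Lemma analytic_exp (c : R) (z0 : C) : analytic_at (fun z => Cexp (RtoC c * z)) z0.
Proof. eapply analytic_of_expands. eexists. apply (expansion_exp c z0 1), Rlt_0_1. Qed.

Lemma analytic_ext (f g : C -> C) (z0 : C) :
  (forall z, f z = g z) -> analytic_at f z0 -> analytic_at g z0.
Proof.
  intros E [a [r H]]. exists a, r. intros z Hz. rewrite <- E. now apply H.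
Qed.

Lemma analytic_minus (f g : C -> C) (z0 : C) :
  analytic_at f z0 -> analytic_at g z0 -> analytic_at (fun z => f z - g z) z0.
Proof.
  intros Hf Hg. apply (analytic_ext (fun z => f z + - (1) * g z)); [intros; ring |].
  apply analytic_plus; [exact Hf |].
  apply (analytic_mult (fun _ => - (1))); [apply analytic_const | exact Hg].
Qed.

Lemma analytic_continuous (f : C -> C) (z0 : C) : analytic_at f z0 -> Ccontinuous f z0.
Proof.
  intros H. destruct (expands_of_analytic f z0 H) as (r & M & HM).
  exact (expands_continuous f z0 r M HM).
Qed.

(** * Identity theorem *)

Lemma Csum_last (u : nat -> C) (k : nat) :
  (forall j, (j < k)%nat -> u j = 0) -> Csum u k = u k.
Proof.
  destruct k as [|k]; intros H.
  - unfold Csum. now rewrite sum_O.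
  - rewrite Csum_S. replace (Csum u k) with (RtoC 0); [ring |].
    assert (Hz : forall m, (m <= k)%nat -> Csum u m = 0).
    { induction m as [|m IH]; intros Hm.
      - unfold Csum. rewrite sum_O. apply H. lia.
      - rewrite Csum_S, IH, H by lia. ring. }
    now rewrite Hz.
Qed.

(** If the coefficients before [a k] vanish, then at a zero [z0 + u] the remainder gives
    [|a k| <= |u| M / r^(k+1)], and there are such zeros with [|u|] arbitrarily small. *)
Lemma expansion_zero_coefs (f : C -> C) (z0 v : C) (r M d : R) (a : nat -> C) :
  expansion f z0 r M a -> v <> 0 -> (0 < d)%R ->
  (forall h : R, (0 < h < d)%R -> f (z0 + RtoC h * v) = 0) ->
  forall k, a k = 0.
Proof.
  intros HE Hv Hd Hf.
  assert (Hr : (0 < r)%R) by apply HE.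
  pose proof (expansion_bound_nonneg _ _ _ _ _ HE) as HM.
  apply Cmod_gt_0 in Hv.
  intros k. induction k as [k IH] using (well_founded_induction Nat.lt_wf_0).
  apply Cmod_eq_0. apply Rle_antisym; [| apply Cmod_ge_0].
  apply Rnot_lt_le. intros Hlt.
  assert (HS : (0 < r ^ S k)%R) by (apply pow_lt, Hr).
  set (e := (Cmod (a k) * r ^ S k / (M + 1))%R).
  assert (He : (0 < e)%R) by (apply Rdiv_lt_0_compat; nra).
  set (h := (Rmin (d / 2) (Rmin (r / Cmod v) (e / Cmod v)))%R).
  assert (Hh : (0 < h)%R).
  { repeat apply Rmin_pos; [lra | |]; apply Rdiv_lt_0_compat; assumption. }
  assert (Hh1 : (h <= d / 2)%R) by apply Rmin_l.
  assert (Hh2 : (h * Cmod v <= r)%R).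
  { replace r with (r / Cmod v * Cmod v)%R by (field; lra).
    apply Rmult_le_compat_r; [lra |]. eapply Rle_trans; [apply Rmin_r | apply Rmin_l]. }
  assert (Hh3 : (h * Cmod v <= e)%R).
  { replace e with (e / Cmod v * Cmod v)%R by (field; lra).
    apply Rmult_le_compat_r; [lra |]. eapply Rle_trans; [apply Rmin_r | apply Rmin_r]. }
  set (z := z0 + RtoC h * v).
  assert (Hu : Cmod (z - z0) = (h * Cmod v)%R).
  { unfold z. replace (z0 + RtoC h * v - z0) with (RtoC h * v) by ring.
    rewrite Cmod_mult, Cmod_RtoC_pos; lra. }
  pose proof (expansion_remainder f z0 r M a z k HE ltac:(rewrite Hu; exact Hh2)) as K.
  rewrite (Csum_last (fun k => a k * (z - z0) ^ k)) in K.
  2:{ intros j Hj. rewrite IH by exact Hj. ring. }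
  unfold z at 1 in K. rewrite Hf in K by lra.
  replace (0 - a k * (z - z0) ^ k) with (- (a k * (z - z0) ^ k)) in K by ring.
  rewrite Cmod_opp, Cmod_mult, Cmod_pow, Hu in K.
  set (q := (h * Cmod v)%R) in *.
  assert (Hq : (0 < q)%R) by (unfold q; nra).
  assert (Hqk : (0 < q ^ k)%R) by (apply pow_lt, Hq).
  assert (K2 : (Cmod (a k) * r ^ S k <= q * M)%R).
  { apply (Rmult_le_reg_r (q ^ k / r ^ S k)).
    - apply Rdiv_lt_0_compat; assumption.
    - replace (Cmod (a k) * r ^ S k * (q ^ k / r ^ S k))%R with (Cmod (a k) * q ^ k)%R
        by (field; lra).
      replace (q * M * (q ^ k / r ^ S k))%R with ((q / r) ^ S k * M)%R; [exact K |].
      unfold Rdiv. rewrite Rpow_mult_distr, pow_inv. simpl (q ^ S k)%R. ring. }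
  assert (K3 : (q * (M + 1) <= Cmod (a k) * r ^ S k)%R).
  { apply (Rmult_le_compat_r (M + 1)) in Hh3; [| lra].
    replace (e * (M + 1))%R with (Cmod (a k) * r ^ S k)%R in Hh3 by (unfold e; field; lra).
    exact Hh3. }
  nra.
Qed.

Lemma analytic_vanish_near (f : C -> C) (z0 v : C) (d : R) :
  analytic_at f z0 -> v <> 0 -> (0 < d)%R ->
  (forall h : R, (0 < h < d)%R -> f (z0 + RtoC h * v) = 0) ->
  exists r, (0 < r)%R /\ forall z, (Cmod (z - z0) < r)%R -> f z = 0.
Proof.
  intros Ha Hv Hd Hf. destruct (expands_of_analytic f z0 Ha) as (r & M & a & HE).
  pose proof (expansion_zero_coefs f z0 v r M d a HE Hv Hd Hf) as Hz.
  destruct HE as [Hr [H _]]. exists r. split; [exact Hr |]. intros z Hlt.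
  apply (Csums_unique (fun _ => RtoC 0)); [| apply Csums_zero].
  apply (Csums_ext (fun k => a k * (z - z0) ^ k)); [intros k; rewrite Hz; ring |].
  apply H. lra.
Qed.

(** The zeros are pushed down the segment: at the lower end of the maximal
    interval on which [f] vanishes, [f] vanishes in a whole disc, so that end can only
    be 0.  The supremum [s] is that of the length [1 - t]. *)
Lemma identity_on_segment (f : C -> C) (v : C) (t0 : R) :
  v <> 0 -> (0 <= t0 < 1)%R ->
  (forall t : R, (0 <= t <= 1)%R -> analytic_at f (RtoC t * v)) ->
  (forall t : R, (t0 < t <= 1)%R -> f (RtoC t * v) = 0) ->
  exists r, (0 < r)%R /\ forall z, (Cmod z < r)%R -> f z = 0.
Proof.
  intros Hv Ht0 Han Hf.
  set (A := fun x : R => (0 <= x <= 1)%R /\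
     forall t : R, (1 - x < t <= 1)%R -> f (RtoC t * v) = 0).
  assert (HA0 : A (1 - t0)%R).
  { split; [lra |]. intros t Ht. apply Hf. lra. }
  destruct (completeness A) as [s [Hub Hlub]].
  - exists 1%R. intros x [Hx _]. lra.
  - now exists (1 - t0)%R.
  - pose proof (Hub _ HA0) as Hs0.
    assert (Hs1 : (s <= 1)%R) by (apply Hlub; intros x [Hx _]; lra).
    assert (Hs : forall t : R, (1 - s < t <= 1)%R -> f (RtoC t * v) = 0).
    { intros t Ht. destruct (classic (exists x, A x /\ (1 - t < x)%R)) as [[x [Ax Hx]] | Hno].
      - apply Ax. lra.
      - exfalso. assert (s <= 1 - t)%R; [| lra]. apply Hlub. intros x Ax.
        apply Rnot_lt_le. intros Hlt. apply Hno. now exists x. }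
    assert (Hloc : exists r, (0 < r)%R /\
       forall z, (Cmod (z - RtoC (1 - s) * v) < r)%R -> f z = 0).
    { apply (analytic_vanish_near f (RtoC (1 - s) * v) v s); [apply Han; lra | exact Hv | lra |].
      intros h Hh. replace (RtoC (1 - s) * v + RtoC h * v) with (RtoC (1 - s + h) * v)
        by (rewrite RtoC_plus; ring). apply Hs. lra. }
    destruct Hloc as [r [Hr Hloc]].
    destruct (Rle_lt_or_eq_dec s 1 Hs1) as [Hlt | ->].
    + exfalso. apply Cmod_gt_0 in Hv.
      set (d := Rmin (1 - s) (r / (2 * Cmod v))).
      assert (Hd0 : (0 < d)%R).
      { apply Rmin_pos; [lra |]. apply Rdiv_lt_0_compat; lra. }
      assert (Hd1 : (d <= 1 - s)%R) by apply Rmin_l.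
      assert (Hd2 : (d * Cmod v <= r / 2)%R).
      { replace (r / 2)%R with (r / (2 * Cmod v) * Cmod v)%R by (field; lra).
        apply Rmult_le_compat_r; [lra | apply Rmin_r]. }
      assert (HA : A (s + d)%R).
      { split; [lra |]. intros t Ht.
        destruct (Rle_lt_dec t (1 - s)) as [Hle | Hgt]; [| apply Hs; lra].
        apply Hloc.
        replace (RtoC t * v - RtoC (1 - s) * v) with (RtoC (t - (1 - s)) * v)
          by (rewrite (RtoC_minus t); ring).
        rewrite Cmod_mult, Cmod_R, Rabs_left1 by lra. nra. }
      specialize (Hub _ HA). lra.
    + exists r. split; [exact Hr |]. intros z Hz. apply Hloc.
      replace (z - RtoC (1 - 1) * v) with z; [exact Hz |].
      replace (1 - 1)%R with 0%R by ring. ring.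
Qed.

(** * Wallis product *)

Definition sin_integral (n : nat) : R := RInt (fun x => (sin x ^ n)%R) 0 (PI / 2).

Lemma sin_integral_correct (n : nat) :
  is_RInt (fun x => (sin x ^ n)%R) 0 (PI / 2) (sin_integral n).
Proof.
  apply (RInt_correct (fun x => (sin x ^ n)%R)).
  apply (ex_RInt_continuous (fun x => (sin x ^ n)%R)). intros x _.
  apply (ex_derive_continuous (fun x => (sin x ^ n)%R)). auto_derive. exact I.
Qed.

(** Integration of the derivative of [- cos x * sin x ^ (n + 1)], which vanishes at both
    ends. *)
Lemma sin_integral_rec (n : nat) :
  (INR (n + 2) * sin_integral (n + 2) = INR (n + 1) * sin_integral n)%R.
Proof.
  pose proof (is_RInt_minus _ _ _ _ _ _
    (is_RInt_scal _ _ _ (INR (n + 2)) _ (sin_integral_correct (n + 2)))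
    (is_RInt_scal _ _ _ (INR (n + 1)) _ (sin_integral_correct n))) as H.
  assert (K : is_RInt (fun x => (INR (n + 2) * sin x ^ (n + 2) - INR (n + 1) * sin x ^ n)%R)
                0 (PI / 2) 0%R).
  { set (F := fun x => (- cos x * sin x ^ (n + 1))%R).
    assert (E : (0 = minus (F (PI / 2)) (F 0))%R).
    { unfold F. rewrite cos_PI2, sin_0, Nat.add_1_r. change (minus ?x ?y) with (x - y)%R.
      simpl. ring. }
    refine (eq_ind _ (fun v : R => is_RInt _ 0 (PI / 2) v) _ _ (eq_sym E)).
    apply (is_RInt_derive F).
    - intros x _. unfold F. auto_derive; [exact I |].
      rewrite !Nat.add_1_r. cbn [pred].
      replace (n + 2)%nat with (S (S n)) by lia. rewrite !S_INR. simpl pow.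
      pose proof (sin2_cos2 x) as T. unfold Rsqr in T.
      assert (T' : (cos x * cos x = 1 - sin x * sin x)%R) by lra.
      transitivity (sin x * sin x * sin x ^ n
                    - (INR n + 1) * sin x ^ n * (cos x * cos x))%R; [ring |].
      rewrite T'. ring.
    - intros x _. apply (ex_derive_continuous
        (fun x => (INR (n + 2) * sin x ^ (n + 2) - INR (n + 1) * sin x ^ n)%R)).
      auto_derive. exact I. }
  pose proof (is_RInt_unique _ _ _ _ H) as H1. pose proof (is_RInt_unique _ _ _ _ K) as K1.
  change (RInt (fun x => (INR (n + 2) * sin x ^ (n + 2) - INR (n + 1) * sin x ^ n)%R) 0 (PI / 2)
    = (INR (n + 2) * sin_integral (n + 2) - INR (n + 1) * sin_integral n)%R) in H1.
  rewrite K1 in H1. lra.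
Qed.

Lemma sin_integral_decr (n : nat) : (sin_integral (S n) <= sin_integral n)%R.
Proof.
  pose proof PI_RGT_0.
  apply (is_RInt_le (fun x => (sin x ^ S n)%R) (fun x => (sin x ^ n)%R) 0 (PI / 2));
    [lra | apply sin_integral_correct | apply sin_integral_correct |].
  intros x Hx.
  assert (0 <= sin x)%R by (apply sin_ge_0; lra).
  pose proof (SIN_bound x). assert (0 <= sin x ^ n)%R by (apply pow_le; lra).
  simpl. nra.
Qed.

Lemma sin_integral_0 : sin_integral 0 = (PI / 2)%R.
Proof.
  unfold sin_integral. simpl. rewrite RInt_const. change (scal ?x ?y) with (x * y)%R. ring.
Qed.

Lemma sin_integral_1 : sin_integral 1 = 1%R.
Proof.
  apply is_RInt_unique.
  assert (E : (1 = minus (- cos (PI / 2)) (- cos 0))%R).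
  { change (minus ?x ?y) with (x - y)%R. rewrite cos_PI2, cos_0. ring. }
  refine (eq_ind _ (fun v : R => is_RInt _ 0 (PI / 2) v) _ _ (eq_sym E)).
  apply (is_RInt_derive (fun x => (- cos x)%R)).
  - intros x _. auto_derive; [exact I | ring].
  - intros x _. apply (ex_derive_continuous (fun x => (sin x ^ 1)%R)). auto_derive. exact I.
Qed.

Lemma sin_integral_pos (n : nat) : (0 < sin_integral n)%R.
Proof.
  induction n as [n IH] using (well_founded_induction Nat.lt_wf_0).
  destruct n as [|[|n]].
  - rewrite sin_integral_0. pose proof PI_RGT_0. lra.
  - rewrite sin_integral_1. lra.
  - pose proof (sin_integral_rec n) as H. specialize (IH n ltac:(lia)).
    assert (0 < INR (n + 2))%R by (apply lt_0_INR; lia).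
    assert (0 < INR (n + 1))%R by (apply lt_0_INR; lia).
    replace (S (S n)) with (n + 2)%nat by lia.
    apply (Rmult_lt_reg_l (INR (n + 2))); [assumption |]. rewrite H. nra.
Qed.

Definition wallis_log (m : nat) : R :=
  (2 * ln (INR (2 * m + 2)) - ln (INR (2 * m + 1)) - ln (INR (2 * m + 3)))%R.

Lemma wallis_log_sum (N : nat) :
  (sum_n wallis_log N =
   ln (PI / 2) - (ln (sin_integral (2 * N + 2)) - ln (sin_integral (2 * N + 3))))%R.
Proof.
  assert (Hrec : forall k, (ln (sin_integral (k + 2)) - ln (sin_integral k)
      = ln (INR (k + 1)) - ln (INR (k + 2)))%R).
  { intros k. pose proof (sin_integral_rec k) as H.
    apply (f_equal ln) in H.
    rewrite !ln_mult in H; try apply sin_integral_pos; try (apply lt_0_INR; lia). lra. }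
  induction N as [|N IH].
  - rewrite sum_O. unfold wallis_log.
    pose proof (Hrec 0%nat) as H0. pose proof (Hrec 1%nat) as H1.
    rewrite sin_integral_0 in H0. rewrite sin_integral_1, ln_1 in H1.
    simpl (2 * 0)%nat. simpl plus in *. simpl Nat.add in *.
    lra.
  - rewrite Rsum_S, IH. unfold wallis_log.
    pose proof (Hrec (2 * N + 2)%nat) as H0. pose proof (Hrec (2 * N + 3)%nat) as H1.
    replace (2 * S N + 2)%nat with (2 * N + 2 + 2)%nat by lia.
    replace (2 * S N + 3)%nat with (2 * N + 3 + 2)%nat by lia.
    replace (2 * S N + 1)%nat with (2 * N + 2 + 1)%nat by lia.
    replace (2 * N + 3 + 1)%nat with (2 * N + 2 + 2)%nat in H1 by lia. lra.
Qed.

Lemma ln_ratio_le (u v : R) : (0 < v <= u)%R -> (0 <= ln u - ln v <= (u - v) / v)%R.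
Proof.
  intros H. split.
  - destruct (Req_dec u v) as [-> | Hne]; [lra |].
    assert (ln v < ln u)%R by (apply ln_increasing; lra). lra.
  - rewrite <- ln_div by lra.
    rewrite <- (ln_exp ((u - v) / v)).
    apply ln_le; [apply Rdiv_lt_0_compat; lra |].
    eapply Rle_trans; [| apply exp_ineq1_le]. right. field. lra.
Qed.

(** The error is [ln] of the quotient of two consecutive sine integrals, which is at most
    [(2n+3)/(2n+2)] by monotonicity and the recurrence. *)
Lemma wallis (eps : R) : (0 < eps)%R ->
  exists N, forall n, (N <= n)%nat -> (Rabs (sum_n wallis_log n - ln (PI / 2)) < eps)%R.
Proof.
  intros He. destruct (INR_unbounded (/ eps)) as [N HN]. exists N. intros n Hn.
  rewrite wallis_log_sum.
  pose proof (sin_integral_pos (2 * n + 3)) as P3. pose proof (sin_integral_pos (2 * n + 2)) as P2.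
  pose proof (sin_integral_decr (2 * n + 2)) as D2.
  pose proof (sin_integral_decr (2 * n + 1)) as D1.
  replace (S (2 * n + 2)) with (2 * n + 3)%nat in D2 by lia.
  replace (S (2 * n + 1)) with (2 * n + 2)%nat in D1 by lia.
  pose proof (sin_integral_rec (2 * n + 1)) as Hr.
  replace (2 * n + 1 + 2)%nat with (2 * n + 3)%nat in Hr by lia.
  replace (2 * n + 1 + 1)%nat with (2 * n + 2)%nat in Hr by lia.
  destruct (ln_ratio_le (sin_integral (2 * n + 2)) (sin_integral (2 * n + 3))) as [L1 L2]; [lra |].
  assert (L3 : ((sin_integral (2 * n + 2) - sin_integral (2 * n + 3))
      / sin_integral (2 * n + 3) <= / INR (2 * n + 2))%R).
  { assert (E : (INR (2 * n + 3) = INR (2 * n + 2) + 1)%R).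
    { replace (2 * n + 3)%nat with (S (2 * n + 2)) by lia. apply S_INR. }
    rewrite E in Hr.
    assert (Hp : (0 < INR (2 * n + 2))%R) by (apply lt_0_INR; lia).
    apply (Rmult_le_reg_r (sin_integral (2 * n + 3))); [exact P3 |].
    unfold Rdiv. rewrite Rmult_assoc, Rinv_l by lra.
    apply (Rmult_le_reg_l (INR (2 * n + 2))); [exact Hp |].
    replace (INR (2 * n + 2) * (/ INR (2 * n + 2) * sin_integral (2 * n + 3)))%R
      with (sin_integral (2 * n + 3)) by (field; lra). nra. }
  assert (L4 : (/ INR (2 * n + 2) < eps)%R).
  { rewrite <- (Rinv_inv eps). apply Rinv_lt_contravar.
    - apply Rmult_lt_0_compat; [now apply Rinv_0_lt_compat | apply lt_0_INR; lia].
    - eapply Rlt_le_trans; [exact HN |]. apply le_INR. lia. }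
  apply Rabs_def1; lra.
Qed.

(** * The value and the derivative of the Riemann zeta function at 0 *)

(** [x^(-z)], for [0 < x]. *)
Definition neg_pow (x : R) (z : C) : C := Cexp (RtoC (- ln x) * z).

Lemma neg_pow_1 (z : C) : neg_pow 1 z = 1.
Proof.
  unfold neg_pow. rewrite ln_1. replace (RtoC (- 0) * z) with (RtoC 0); [apply Cexp_0 |].
  rewrite Ropp_0. ring.
Qed.

Lemma neg_pow_mult (x y : R) (z : C) :
  (0 < x)%R -> (0 < y)%R -> neg_pow (x * y) z = neg_pow x z * neg_pow y z.
Proof.
  intros Hx Hy. unfold neg_pow. rewrite ln_mult by assumption. rewrite <- Cexp_add. f_equal.
  rewrite Ropp_plus_distr, RtoC_plus. ring.
Qed.

Lemma neg_pow_at_0 (x : R) : neg_pow x 0 = 1.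
Proof. unfold neg_pow. replace (RtoC (- ln x) * 0) with (RtoC 0) by ring. apply Cexp_0. Qed.

(** Second differences of [n^(-z)] instead of the terms of the alternating zeta series:
    they decrease like [n^(-2 - Re z)], so that their sum converges absolutely around
    [z = 0]. *)
Definition alt_term (m : nat) (z : C) : C :=
  neg_pow (INR (2 * m + 1)) z - 2 * neg_pow (INR (2 * m + 2)) z + neg_pow (INR (2 * m + 3)) z.

(** The two terms removed from the exponential series leave a factor [(|c| B)^2], where
    [B] is the norm of the identity function. *)
Lemma expands_exp_second_order (c : R) (z0 : C) (r B : R) :
  (0 < r)%R -> B = (Cmod z0 + r)%R ->
  expands (fun z => Cexp (RtoC c * z) - 1 - RtoC c * z) z0 r
    ((Rabs c * B) ^ 2 * exp (Rabs c * B))%R.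
Proof.
  intros Hr HB.
  assert (HB0 : (0 <= B)%R) by (pose proof (Cmod_ge_0 z0); lra).
  assert (Hx : (0 <= Rabs c * B)%R) by (apply Rmult_le_pos; [apply Rabs_pos | exact HB0]).
  apply (expands_series (fun n z => exp_term (RtoC c) (S (S n)) * z ^ S (S n)) _ z0 r
     (fun n => (Rabs c ^ S (S n) / INR (fact (S (S n)))) * B ^ S (S n))%R).
  - intros n. rewrite <- (Cmod_R c), <- Cmod_exp_term. apply expands_scal, expands_pow.
    rewrite HB. now apply expands_id.
  - intros N.
    apply Rle_trans with (sum_n (fun n => (Rabs c * B) ^ 2 *
        ((Rabs c * B) ^ n / INR (fact n)))%R N).
    + apply Rsum_le. intros n.
      replace (Rabs c ^ S (S n) / INR (fact (S (S n))) * B ^ S (S n))%R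
        with ((Rabs c * B) ^ 2 * ((Rabs c * B) ^ n * / INR (fact (S (S n)))))%R
        by (rewrite !Rpow_mult_distr; simpl pow; unfold Rdiv; ring).
      apply Rmult_le_compat_l; [now apply pow_le |].
      apply Rmult_le_compat_l; [now apply pow_le |].
      apply Rinv_le_contravar; [apply INR_fact_lt_0 |].
      apply le_INR, fact_le. lia.
    + rewrite Rsum_scal. apply Rmult_le_compat_l; [now apply pow_le |]. now apply exp_partial_le.
  - intros z _.
    pose proof (Csums_tail _ _ (Csums_tail _ _ (Cexp_series (RtoC c * z)))) as H.
    cbv beta in H.
    replace (Cexp (RtoC c * z) - exp_term (RtoC c * z) 0 - exp_term (RtoC c * z) 1)
      with (Cexp (RtoC c * z) - 1 - RtoC c * z) in H by (unfold exp_term; simpl; field).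
    eapply Csums_ext; [| exact H]. intros n. unfold exp_term.
    rewrite Cpow_mult_l. unfold Cdiv. ring.
Qed.

Lemma exp_half_ln (x : R) : (0 < x)%R -> exp (ln x * / 2) = sqrt x.
Proof.
  intros Hx. rewrite <- (Rpower_sqrt x Hx). unfold Rpower. f_equal. ring.
Qed.

(** Twice [B], plus [5 B^2 exp B], bounds the norm of
    [x^2 * (exp (al z) + exp (- be z) - 2)] in the next lemma, where [B] is the norm of
    the identity function on the disc of radius [1/2] at [z0]. *)
Definition alt_const (z0 : C) : R :=
  let B := (Cmod z0 + / 2)%R in (5 * B ^ 2 * exp B + 2 * B)%R.

(** With [x = 2m + 2], [al = ln x - ln (x - 1)] and [be = ln (x + 1) - ln x], the term is
    [x^(-z) * (exp (al z) + exp (- be z) - 2)].  The second factor has norm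
    [O (x^(-2))], since [al] and [be] are [O (1/x)] and [al - be] is [O (1/x^2)]; the
    first has norm at most [x^(1/2)] on a disc of radius [1/2], whence the exponent
    [3/2]. *)
Lemma expands_alt_term (m : nat) (z0 : C) : (0 <= Re z0)%R ->
  expands (alt_term m) z0 (/ 2)
    (alt_const z0 * / (INR (S m) * sqrt (INR (S m))))%R.
Proof.
  intros Hre. unfold alt_const. set (B := (Cmod z0 + / 2)%R). cbv zeta.
  assert (HB : (0 <= B)%R) by (unfold B; pose proof (Cmod_ge_0 z0); lra).
  set (y := INR (S m)).
  assert (Hy : (1 <= y)%R) by (unfold y; rewrite S_INR; pose proof (pos_INR m); lra).
  assert (E2 : INR (2 * m + 2) = (2 * y)%R).
  { unfold y. rewrite plus_INR, mult_INR, (S_INR m). simpl. ring. }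
  assert (E1 : INR (2 * m + 1) = (2 * y - 1)%R).
  { unfold y. rewrite plus_INR, mult_INR, (S_INR m). simpl. ring. }
  assert (E3 : INR (2 * m + 3) = (2 * y + 1)%R).
  { unfold y. rewrite plus_INR, mult_INR, (S_INR m). simpl. ring. }
  set (x := (2 * y)%R) in *.
  assert (Hx : (2 <= x)%R) by (unfold x; lra).
  set (al := (ln x - ln (x - 1))%R). set (be := (ln (x + 1) - ln x)%R).
  assert (Hal : (0 <= al <= 2 / x)%R).
  { destruct (ln_ratio_le x (x - 1)) as [L1 L2]; [lra |]. fold al in L1, L2. split; [exact L1 |].
    eapply Rle_trans; [exact L2 |].
    apply (Rmult_le_reg_r ((x - 1) * x)); [nra |].
    replace ((x - (x - 1)) / (x - 1) * ((x - 1) * x))%R with x by (field; lra).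
    replace (2 / x * ((x - 1) * x))%R with (2 * (x - 1))%R by (field; lra). lra. }
  assert (Hbe : (0 <= be <= / x)%R).
  { destruct (ln_ratio_le (x + 1) x) as [L1 L2]; [lra |]. fold be in L1, L2. split; [exact L1 |].
    eapply Rle_trans; [exact L2 |]. right. field. lra. }
  assert (Hab : (0 <= al - be <= 2 / x ^ 2)%R).
  { destruct (ln_ratio_le (x * x) ((x - 1) * (x + 1))) as [L1 L2]; [nra |].
    rewrite !ln_mult in L1, L2 by lra.
    assert (E : (al - be = ln x + ln x - (ln (x - 1) + ln (x + 1)))%R) by (unfold al, be; ring).
    rewrite E. split; [exact L1 |]. eapply Rle_trans; [exact L2 |].
    assert (0 < (x - 1) * (x + 1))%R by nra.
    apply (Rmult_le_reg_r ((x - 1) * (x + 1) * x ^ 2)); [nra |].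
    replace ((x * x - (x - 1) * (x + 1)) / ((x - 1) * (x + 1)) * ((x - 1) * (x + 1) * x ^ 2))%R
      with (x ^ 2)%R by (field; lra).
    replace (2 / x ^ 2 * ((x - 1) * (x + 1) * x ^ 2))%R with (2 * ((x - 1) * (x + 1)))%R
      by (field; lra). nra. }
  assert (Hix : (0 < / x <= / 2)%R).
  { split; [apply Rinv_0_lt_compat; lra | apply Rinv_le_contravar; lra]. }
  assert (Hhalf : (0 < / 2)%R) by lra.
  apply (expands_ext (fun z => neg_pow x z *
    ((Cexp (RtoC al * z) - 1 - RtoC al * z) + (Cexp (RtoC (- be) * z) - 1 - RtoC (- be) * z)
      + RtoC (al - be) * z))).
  { intros z _. unfold alt_term. rewrite E1, E2, E3.
    assert (R1 : neg_pow (x - 1) z = neg_pow x z * Cexp (RtoC al * z)).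
    { unfold neg_pow. rewrite <- Cexp_add. f_equal. unfold al. rewrite RtoC_minus, !RtoC_opp. ring. }
    assert (R3 : neg_pow (x + 1) z = neg_pow x z * Cexp (RtoC (- be) * z)).
    { unfold neg_pow. rewrite <- Cexp_add. f_equal. unfold be.
      rewrite !RtoC_opp, RtoC_minus. ring. }
    rewrite R1, R3, RtoC_minus, !RtoC_opp. ring. }
  (* The norm as the algebra of expansions gives it; what remains is a real inequality. *)
  apply (expands_le _ _ _ ((exp (- ln x * Re z0) * exp (Rabs (- ln x) * / 2)) *
     ((Rabs al * B) ^ 2 * exp (Rabs al * B) + (Rabs (- be) * B) ^ 2 * exp (Rabs (- be) * B)
       + Cmod (RtoC (al - be)) * B))%R).
  2:{ apply expands_mult.
      - eexists. apply expansion_exp. exact Hhalf.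
      - apply expands_plus; [apply expands_plus |].
        + now apply expands_exp_second_order.
        + now apply expands_exp_second_order.
        + apply expands_scal. now apply expands_id. }
  assert (Hln : (0 <= ln x)%R).
  { rewrite <- ln_1. apply ln_le; lra. }
  rewrite Cmod_RtoC_pos by lra. rewrite !Rabs_Ropp, !Rabs_pos_eq by lra.
  rewrite exp_half_ln by lra.
  set (s := sqrt y).
  assert (Hs : (1 <= s)%R) by (unfold s; rewrite <- sqrt_1; apply sqrt_le_1; lra).
  assert (Hss : (s * s = y)%R) by (apply sqrt_sqrt; lra).
  assert (Hsx : (sqrt x <= 2 * s)%R).
  { replace (2 * s)%R with (sqrt ((2 * s) * (2 * s))) by (apply sqrt_square; lra).
    apply sqrt_le_1; unfold x; nra. }
  assert (HeB : (exp (- ln x * Re z0) <= 1)%R).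
  { rewrite <- exp_0. assert (E : (- ln x * Re z0 <= 0)%R) by nra.
    destruct E as [E | ->]; [left; now apply exp_increasing | right; reflexivity]. }
  assert (Hexp : forall t, (0 <= t <= 1)%R -> (exp (t * B) <= exp B)%R).
  { intros t Ht. assert (E : (t * B <= B)%R) by nra.
    destruct E as [E | ->]; [left; now apply exp_increasing | right; reflexivity]. }
  set (w := (/ x)%R) in *.
  assert (Hw2 : (2 / x = 2 * w)%R) by reflexivity.
  assert (Hw3 : (2 / x ^ 2 = 2 * w ^ 2)%R) by (unfold w; field; lra).
  rewrite Hw2 in Hal. rewrite Hw3 in Hab.
  pose proof (Hexp al ltac:(lra)) as X1. pose proof (Hexp be ltac:(lra)) as X2.
  pose proof (exp_pos (al * B)) as X3. pose proof (exp_pos (be * B)) as X4.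
  assert (T1 : ((al * B) ^ 2 * exp (al * B) <= 4 * w ^ 2 * B ^ 2 * exp B)%R).
  { apply Rmult_le_compat; [apply pow2_ge_0 | lra | | exact X1].
    replace (4 * w ^ 2 * B ^ 2)%R with ((2 * w * B) ^ 2)%R by ring.
    apply pow_incr. split; [nra |]. apply Rmult_le_compat_r; lra. }
  assert (T2 : ((be * B) ^ 2 * exp (be * B) <= w ^ 2 * B ^ 2 * exp B)%R).
  { apply Rmult_le_compat; [apply pow2_ge_0 | lra | | exact X2].
    replace (w ^ 2 * B ^ 2)%R with ((w * B) ^ 2)%R by ring.
    apply pow_incr. split; [nra |]. apply Rmult_le_compat_r; lra. }
  assert (T3 : ((al - be) * B <= 2 * w ^ 2 * B)%R) by (apply Rmult_le_compat_r; lra).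
  set (Q := ((al * B) ^ 2 * exp (al * B) + (be * B) ^ 2 * exp (be * B) + (al - be) * B)%R) in *.
  assert (HQ : (0 <= Q <= w ^ 2 * (5 * B ^ 2 * exp B + 2 * B))%R).
  { split.
    - unfold Q. apply Rplus_le_le_0_compat; [apply Rplus_le_le_0_compat |].
      + apply Rmult_le_pos; [apply pow2_ge_0 | lra].
      + apply Rmult_le_pos; [apply pow2_ge_0 | lra].
      + apply Rmult_le_pos; lra.
    - unfold Q. lra. }
  set (K := (5 * B ^ 2 * exp B + 2 * B)%R) in *.
  assert (HK : (0 <= K)%R).
  { unfold K. pose proof (exp_pos B). pose proof (pow2_ge_0 B). nra. }
  apply Rle_trans with (1 * (2 * s) * (w ^ 2 * K))%R.
  - apply Rmult_le_compat; [| lra | | lra].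
    + apply Rmult_le_pos; [apply Rlt_le, exp_pos | apply sqrt_pos].
    + apply Rmult_le_compat; [apply Rlt_le, exp_pos | apply sqrt_pos | exact HeB | exact Hsx].
  - assert (Hw : (w = / (2 * (s * s)))%R) by (unfold w, x; rewrite Hss; reflexivity).
    rewrite Hw, <- Hss.
    apply Rle_trans with (K * / (s * s * s) * / 2)%R; [right; field; lra |].
    assert (0 <= K * / (s * s * s))%R; [| lra].
    apply Rmult_le_pos; [exact HK |]. apply Rlt_le, Rinv_0_lt_compat.
    apply Rmult_lt_0_compat; nra.
Qed.

Lemma sum_inv_three_halves (N : nat) :
  (sum_n (fun m => / (INR (S m) * sqrt (INR (S m))))%R N <= 3 - 2 / sqrt (INR (S N)))%R.
Proof.
  induction N as [|N IH].
  - rewrite sum_O. simpl. rewrite sqrt_1. lra.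
  - rewrite Rsum_S.
    set (a := sqrt (INR (S N))) in *. set (b := sqrt (INR (S (S N)))).
    assert (Ha : (0 < a)%R) by (apply sqrt_lt_R0, lt_0_INR; lia).
    assert (Hb : (0 < b)%R) by (apply sqrt_lt_R0, lt_0_INR; lia).
    assert (Haa : (a * a = INR (S N))%R) by (apply sqrt_sqrt, pos_INR).
    assert (Hbb : (b * b = INR (S (S N)))%R) by (apply sqrt_sqrt, pos_INR).
    assert (Hdiff : (b * b - a * a = 1)%R) by (rewrite Haa, Hbb, (S_INR (S N)); ring).
    rewrite <- Hbb.
    assert (E : (/ (b * b * b) <= 2 / a - 2 / b)%R); [| lra].
    assert (Hlt : (a < b)%R) by nra.
    apply (Rmult_le_reg_r (a * (b * b * b))); [apply Rmult_lt_0_compat; nra |].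
    replace (/ (b * b * b) * (a * (b * b * b)))%R with a by (field; lra).
    replace ((2 / a - 2 / b) * (a * (b * b * b)))%R with (2 * (b - a) * (b * b))%R by (field; lra).
    apply Rle_trans with ((b - a) * (b + a) * b)%R; [nra |].
    replace (2 * (b - a) * (b * b))%R with ((b - a) * (2 * b) * b)%R by ring.
    apply Rmult_le_compat_r; [lra |]. apply Rmult_le_compat_l; lra.
Qed.

Lemma expands_bound (f : C -> C) (z0 z : C) (r M : R) :
  expands f z0 r M -> (Cmod (z - z0) <= r)%R -> (Cmod (f z) <= M)%R.
Proof.
  intros [a [Hr [H HM]]] Hz. apply (Csums_Cmod_le _ _ _ (H z Hz)).
  intros N. eapply Rle_trans; [apply Cmod_Csum_le |]. eapply Rle_trans; [| apply (HM N)].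
  apply Rsum_le. intros k. rewrite Cmod_mult, Cmod_pow.
  apply Rmult_le_compat_l; [apply Cmod_ge_0 |]. apply pow_incr. split; [apply Cmod_ge_0 | exact Hz].
Qed.

Definition alt_zeta (z : C) : C := CSeries (fun m => alt_term m z).

Lemma alt_zeta_near (z0 : C) : (0 <= Re z0)%R ->
  analytic_at alt_zeta z0 /\ Csums (fun m => alt_term m z0) (alt_zeta z0) /\
  (forall d, (forall m, Cderiv (alt_term m) z0 (d m)) ->
     exists D, Csums d D /\ Cderiv alt_zeta z0 D).
Proof.
  intros Hre.
  set (M := fun m => (alt_const z0 * / (INR (S m) * sqrt (INR (S m))))%R).
  assert (Hexp : forall m, expands (alt_term m) z0 (/ 2) (M m))
    by (intros m; now apply expands_alt_term).
  assert (HK : (0 <= alt_const z0)%R).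
  { unfold alt_const. pose proof (Cmod_ge_0 z0). set (B := (Cmod z0 + / 2)%R).
    assert (0 <= B)%R by (unfold B; lra). pose proof (exp_pos B). pose proof (pow2_ge_0 B).
    cbv zeta. nra. }
  assert (HS : forall N, (sum_n M N <= alt_const z0 * 3)%R).
  { intros N. unfold M. rewrite Rsum_scal. apply Rmult_le_compat_l; [exact HK |].
    eapply Rle_trans; [apply sum_inv_three_halves |].
    assert (0 < 2 / sqrt (INR (S N)))%R; [| lra].
    apply Rdiv_lt_0_compat; [lra |]. apply sqrt_lt_R0, lt_0_INR. lia. }
  assert (Hsum : forall z, (Cmod (z - z0) <= / 2)%R ->
            Csums (fun m => alt_term m z) (alt_zeta z)).
  { intros z Hz. destruct (Csums_abs (fun m => alt_term m z) (alt_const z0 * 3)) as [l Hl].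
    - intros N. eapply Rle_trans; [| apply (HS N)]. apply Rsum_le. intros m.
      exact (expands_bound _ z0 z _ _ (Hexp m) Hz).
    - unfold alt_zeta. now rewrite (CSeries_correct _ l Hl). }
  destruct (expands_series alt_term alt_zeta z0 (/ 2) M _ Hexp HS Hsum) as [H1 H2].
  split; [eapply analytic_of_expands, H1 | split; [| exact H2]].
  apply Hsum. replace (z0 - z0) with (RtoC 0) by ring. rewrite Cmod_0. lra.
Qed.

(** The odd terms up to [2N + 3] are all the terms minus the even ones, and the even
    terms are [2^(-z)] times the terms up to [N + 1]. *)
Lemma alt_partial_sum (z : C) (N : nat) :
  let s := Csum (fun k => neg_pow (INR (S k)) z) in
  Csum (fun m => alt_term m z) N
  = 2 * s (2 * N + 2)%nat - 4 * neg_pow 2 z * s N - 1 - neg_pow (INR (2 * N + 3)) z.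
Proof.
  cbv zeta.
  assert (Hdouble : forall k, neg_pow (INR (2 * k + 2)) z = neg_pow 2 z * neg_pow (INR (S k)) z).
  { intros k. rewrite <- neg_pow_mult by (try (apply lt_0_INR; lia); lra). f_equal.
    rewrite plus_INR, mult_INR, (S_INR k). simpl. ring. }
  set (p := fun k => neg_pow (INR (S k)) z).
  induction N as [|N IH].
  - change (2 * 0 + 2)%nat with 2%nat. rewrite !Csum_S. unfold Csum. rewrite !sum_O.
    unfold p, alt_term.
    change (2 * 0 + 1)%nat with 1%nat. change (2 * 0 + 2)%nat with 2%nat.
    change (2 * 0 + 3)%nat with 3%nat.
    replace (neg_pow (INR 2) z) with (neg_pow 2 z) by (f_equal; simpl; ring).
    replace (neg_pow (INR 1) z) with (RtoC 1) by (symmetry; apply neg_pow_1).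
    replace (RtoC 4) with (RtoC 2 + RtoC 2) by (rewrite <- RtoC_plus; f_equal; ring).
    ring.
  - rewrite Csum_S, IH.
    replace (2 * S N + 2)%nat with (S (S (2 * N + 2))) by lia. rewrite !Csum_S.
    unfold alt_term. rewrite Hdouble. unfold p.
    replace (S (S (2 * N + 2))) with (2 * S N + 2)%nat by lia.
    replace (S (2 * S N + 2)) with (2 * S N + 3)%nat by lia.
    rewrite Hdouble.
    replace (2 * S N + 1)%nat with (2 * N + 3)%nat by lia.
    replace (RtoC 4) with (RtoC 2 + RtoC 2) by (rewrite <- RtoC_plus; f_equal; ring).
    ring.
Qed.

Lemma alt_zeta_of_zeta (z l : C) : (0 <= Re z)%R ->
  Csums (fun k => neg_pow (INR (S k)) z) l ->
  alt_zeta z = 2 * (1 - 2 * neg_pow 2 z) * l - 1.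
Proof.
  intros Hre Hl. apply (Csums_unique (fun m => alt_term m z)); [now apply alt_zeta_near |].
  apply Csums_iff. intros eps He.
  set (A := Cmod (4 * neg_pow 2 z)).
  assert (HA : (0 <= A)%R) by apply Cmod_ge_0.
  set (e := (eps / (3 + A))%R).
  assert (Hpos : (0 < e)%R) by (apply Rdiv_lt_0_compat; lra).
  destruct (proj1 (Csums_iff _ _) Hl e Hpos) as [N HN].
  exists N. intros n Hn. rewrite alt_partial_sum.
  set (s := Csum (fun k => neg_pow (INR (S k)) z)) in *.
  assert (Es : s (2 * n + 2)%nat = s (2 * n + 1)%nat + neg_pow (INR (2 * n + 3)) z).
  { replace (2 * n + 2)%nat with (S (2 * n + 1)) by lia. unfold s at 1. rewrite Csum_S.
    replace (S (S (2 * n + 1))) with (2 * n + 3)%nat by lia. reflexivity. }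
  pose proof (HN (2 * n + 2)%nat ltac:(lia)) as H1.
  pose proof (HN (2 * n + 1)%nat ltac:(lia)) as H2.
  pose proof (HN n Hn) as H3.
  replace (neg_pow (INR (2 * n + 3)) z) with (s (2 * n + 2)%nat - s (2 * n + 1)%nat)
    by (rewrite Es; ring).
  match goal with |- (Cmod ?x < _)%R => replace x with
    ((s (2 * n + 2)%nat - l) + (s (2 * n + 1)%nat - l) + - (4 * neg_pow 2 z * (s n - l))) end.
  2:{ replace (RtoC 4) with (RtoC 2 + RtoC 2) by (rewrite <- RtoC_plus; f_equal; ring). ring. }
  eapply Rle_lt_trans; [apply Cmod_triangle |]. rewrite Cmod_opp, Cmod_mult. fold A.
  pose proof (Cmod_triangle (s (2 * n + 2)%nat - l) (s (2 * n + 1)%nat - l)) as T.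
  replace eps with ((3 + A) * e)%R by (unfold e; field; lra). nra.
Qed.

(** The two normed modules on [C] have the same norm but different, equivalent, uniform
    structures; the product rule is stated for the second one. *)
Lemma Cderiv_iff_AbsRing (f : C -> C) (z l : C) :
  Cderiv f z l <-> @is_derive C_AbsRing (AbsRing_NormedModule C_AbsRing) f z l.
Proof.
  split; intros [_ H]; (split; [apply is_linear_scal_l | exact H]).
Qed.

Lemma Cderiv_mult (f g : C -> C) (z l m : C) :
  Cderiv f z l -> Cderiv g z m -> Cderiv (fun x => f x * g x) z (l * g z + f z * m).
Proof.
  rewrite !Cderiv_iff_AbsRing. intros Hf Hg.
  exact (is_derive_mult (K := C_AbsRing) f g z l m Hf Hg Cmult_comm).
Qed.

Lemma Cderiv_plus (f g : C -> C) (z l m : C) :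
  Cderiv f z l -> Cderiv g z m -> Cderiv (fun x => f x + g x) z (l + m).
Proof. exact (is_derive_plus f g z l m). Qed.

Lemma Cderiv_minus (f g : C -> C) (z l m : C) :
  Cderiv f z l -> Cderiv g z m -> Cderiv (fun x => f x - g x) z (l - m).
Proof. exact (is_derive_minus f g z l m). Qed.

Lemma Cderiv_const (c z : C) : Cderiv (fun _ => c) z (RtoC 0).
Proof. exact (is_derive_const c z). Qed.

Lemma Cderiv_near (f g : C -> C) (z l : C) (r : R) : (0 < r)%R ->
  (forall y, (Cmod (y - z) < r)%R -> f y = g y) -> Cderiv f z l -> Cderiv g z l.
Proof.
  intros Hr H. apply (@is_derive_ext_loc C_AbsRing C_NormedModule).
  exists (mkposreal r Hr). intros y Hy. now apply H.
Qed.

Lemma Cderiv_neg_pow_0 (x : R) : Cderiv (neg_pow x) (RtoC 0) (RtoC (- ln x)).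
Proof.
  pose proof (Cderiv_exp (- ln x) 0) as H.
  change (Cexp (RtoC (- ln x) * 0)) with (neg_pow x 0) in H. rewrite neg_pow_at_0 in H.
  replace (RtoC (- ln x) * 1) with (RtoC (- ln x)) in H by ring. exact H.
Qed.

Lemma analytic_neg_pow (x : R) (z0 : C) : analytic_at (neg_pow x) z0.
Proof. exact (analytic_exp (- ln x) z0). Qed.

Lemma alt_term_at_0 (m : nat) : alt_term m 0 = 0.
Proof. unfold alt_term. rewrite !neg_pow_at_0. ring. Qed.

Lemma Cderiv_alt_term (m : nat) : Cderiv (alt_term m) (RtoC 0) (RtoC (wallis_log m)).
Proof.
  unfold alt_term, wallis_log.
  pose proof (Cderiv_plus _ _ _ _ _ (Cderiv_minus _ _ _ _ _ (Cderiv_neg_pow_0 (INR (2 * m + 1)))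
    (Cderiv_mult _ _ _ _ _ (Cderiv_const 2 0) (Cderiv_neg_pow_0 (INR (2 * m + 2)))))
    (Cderiv_neg_pow_0 (INR (2 * m + 3)))) as H.
  cbv beta in H. rewrite neg_pow_at_0 in H.
  match type of H with Cderiv _ _ ?l => replace l with
    (RtoC (2 * ln (INR (2 * m + 2)) - ln (INR (2 * m + 1)) - ln (INR (2 * m + 3)))) in H end.
  - exact H.
  - rewrite !RtoC_minus, RtoC_mult, !RtoC_opp. ring.
Qed.

Lemma alt_zeta_at_0 : alt_zeta 0 = 0.
Proof.
  apply (Csums_unique (fun m => alt_term m 0)).
  - apply alt_zeta_near. simpl. lra.
  - apply (Csums_ext (fun _ => RtoC 0)); [intros m; now rewrite alt_term_at_0 | apply Csums_zero].
Qed.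

Lemma Cderiv_alt_zeta : Cderiv alt_zeta (RtoC 0) (RtoC (ln (PI / 2))).
Proof.
  destruct (alt_zeta_near 0) as [_ [_ H]]; [simpl; lra |].
  destruct (H _ Cderiv_alt_term) as [D [HD HF]].
  replace (RtoC (ln (PI / 2))) with D; [exact HF |].
  apply (Csums_unique (fun m => RtoC (wallis_log m))); [exact HD |].
  assert (E : forall n, Csum (fun m => RtoC (wallis_log m)) n = RtoC (sum_n wallis_log n)).
  { induction n as [|n IH].
    - unfold Csum. now rewrite !sum_O.
    - rewrite Csum_S, Rsum_S, RtoC_plus, IH. reflexivity. }
  apply Csums_iff. intros eps He. destruct (wallis eps He) as [N HN].
  exists N. intros n Hn. rewrite E, <- RtoC_minus, Cmod_R. now apply HN.
Qed.

(** The point [3 + i]: the segment from it to 0 starts in [Re z > 2] and avoids 1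
    and 2. *)
Definition segment_end : C := (3, 1)%R.

Lemma segment_end_neq_0 : segment_end <> 0.
Proof. intros H. apply (f_equal fst) in H. simpl in H. lra. Qed.

Lemma Re_segment_end (t : R) : Re (RtoC t * segment_end) = (3 * t)%R.
Proof. unfold segment_end, Re, Cmult, RtoC. simpl. ring. Qed.

Definition analytic_on_segment (f : C -> C) : Prop :=
  forall t : R, (0 <= t <= 1)%R -> analytic_at f (RtoC t * segment_end).

Lemma continuation_unique (f g : C -> C) :
  analytic_on_segment f -> analytic_on_segment g ->
  (forall z, (2 < Re z)%R -> f z = g z) ->
  exists r, (0 < r)%R /\ forall z, (Cmod (z - 0) < r)%R -> f z = g z.
Proof.
  intros Hf Hg H.
  destruct (identity_on_segment (fun z => f z - g z) segment_end (2 / 3)) as [r [Hr K]].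
  - apply segment_end_neq_0.
  - lra.
  - intros t Ht. apply analytic_minus; auto.
  - intros t Ht. rewrite H; [ring |]. rewrite Re_segment_end. lra.
  - exists r. split; [exact Hr |]. intros z Hz.
    replace (z - 0) with z in Hz by ring. specialize (K z Hz).
    replace (f z) with (f z - g z + g z) by ring. rewrite K. ring.
Qed.

(** Both values follow from [alt_zeta z = 2 (1 - 2 * 2^(-z)) zeta z - 1] near 0, where
    [alt_zeta] vanishes at 0 and has derivative [ln (pi / 2)] there. *)
Lemma zeta_at_0 (zeta : C -> C) (l : C) :
  analytic_on_segment zeta ->
  (forall z, (2 < Re z)%R -> Csums (fun k => neg_pow (INR (S k)) z) (zeta z)) ->
  Cderiv zeta (RtoC 0) l ->
  zeta 0 = RtoC (- / 2) /\ l = RtoC (- / 2 * ln (2 * PI)).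
Proof.
  intros Han Hsum Hd.
  set (h := fun z => 2 * (1 - 2 * neg_pow 2 z) * zeta z - 1).
  destruct (continuation_unique alt_zeta h) as [r [Hr E]].
  - intros t Ht. apply alt_zeta_near. rewrite Re_segment_end. lra.
  - intros t Ht. unfold h. apply analytic_minus; [| apply analytic_const].
    apply analytic_mult; [| now apply Han].
    apply (analytic_mult (fun _ => RtoC 2)); [apply analytic_const |].
    apply analytic_minus; [apply analytic_const |].
    apply (analytic_mult (fun _ => RtoC 2)); [apply analytic_const | apply analytic_neg_pow].
  - intros z Hz. apply alt_zeta_of_zeta; [lra | now apply Hsum].
  - assert (E0 : zeta 0 = RtoC (- / 2)).
    { specialize (E 0). rewrite alt_zeta_at_0 in E. unfold h in E. rewrite neg_pow_at_0 in E.
      assert (H0 : RtoC 0 = 2 * (1 - 2 * 1) * zeta 0 - 1).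
      { apply E. replace (0 - 0) with (RtoC 0) by ring. now rewrite Cmod_0. }
      rewrite RtoC_opp, RtoC_inv by lra.
      replace (zeta 0) with (- / 2 * (2 * (1 - 2 * 1) * zeta 0 - 1) - / 2) by field.
      rewrite <- H0. ring. }
    split; [exact E0 |].
    assert (Hh : Cderiv h (RtoC 0) (2 * RtoC (2 * ln 2) * zeta 0 - 2 * l)).
    { pose proof (Cderiv_minus _ _ _ _ _ (Cderiv_mult _ _ _ _ _
        (Cderiv_mult _ _ _ _ _ (Cderiv_const 2 0) (Cderiv_minus _ _ _ _ _ (Cderiv_const 1 0)
           (Cderiv_mult _ _ _ _ _ (Cderiv_const 2 0) (Cderiv_neg_pow_0 2)))) Hd)
        (Cderiv_const 1 0)) as H.
      cbv beta in H. rewrite neg_pow_at_0 in H.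
      match type of H with Cderiv _ _ ?m => replace m with
        (2 * RtoC (2 * ln 2) * zeta 0 - 2 * l) in H end; [exact H |].
      rewrite RtoC_mult, RtoC_opp. ring. }
    pose proof (Cderiv_unique h 0 _ _ Hh (Cderiv_near _ _ _ _ r Hr E Cderiv_alt_zeta)) as U.
    rewrite E0 in U.
    assert (Hln : (ln (2 * PI) = ln (PI / 2) + 2 * ln 2)%R).
    { pose proof PI_RGT_0. replace (2 * PI)%R with (PI / 2 * (2 * 2))%R by field.
      rewrite !ln_mult by lra. ring. }
    rewrite Hln.
    assert (U2 : 2 * l = 2 * RtoC (2 * ln 2) * RtoC (- / 2) - RtoC (ln (PI / 2)))
      by (rewrite <- U; ring).
    replace l with (/ 2 * (2 * l)) by field. rewrite U2.
    rewrite <- !RtoC_mult, <- RtoC_minus, <- RtoC_inv, <- RtoC_mult by lra. f_equal. field.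
Qed.

(** * Shifts of the Barnes zeta and gamma functions *)

Lemma Cpower_neg_pow (x : R) (z : C) : (0 < x)%R -> Cpower (RtoC x) (- z) = neg_pow x z.
Proof.
  intros Hx. unfold Cpower, Clog, neg_pow. rewrite Cmod_RtoC_pos by lra.
  replace (Im (RtoC x) / Re (RtoC x))%R with 0%R by (simpl; field; lra).
  rewrite atan_0. change ((ln x, 0%R)) with (RtoC (ln x)). f_equal. rewrite RtoC_opp. ring.
Qed.

Lemma barnes_term (tau w : R) (z : C) (k1 k2 : nat) : (0 < tau)%R -> (0 < w)%R ->
  Cpower (RtoC w + INR k1 + INR k2 * tau) (- z) = neg_pow (w + INR k1 + INR k2 * tau)%R z.
Proof.
  intros Ht Hw. rewrite <- RtoC_mult, <- !RtoC_plus. apply Cpower_neg_pow.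
  pose proof (pos_INR k1). pose proof (pos_INR k2). nra.
Qed.

Lemma barnes_zeta2_rows (tau w : R) (Z : C -> C) (z : C) : (0 < tau)%R -> (0 < w)%R ->
  is_barnes_zeta2 tau (RtoC w) Z -> (2 < Re z)%R ->
  exists row : nat -> C,
    (forall k1, Csums (fun k2 => neg_pow (w + INR k1 + INR k2 * tau)%R z) (row k1)) /\
    Csums row (Z z).
Proof.
  intros Ht Hw [_ H] Hz. destruct (H z Hz) as [row [Hrow Hsum]].
  exists row. split; [| exact Hsum]. intros k1.
  eapply Csums_ext; [| apply Hrow]. intros k2. now apply barnes_term.
Qed.

(** The shift by 1 moves row [k1] to row [k1 + 1], so only row 0 is left. *)
Lemma barnes_zeta2_shift_1 (tau w : R) (Z Z' : C -> C) (z : C) : (0 < tau)%R -> (0 < w)%R ->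
  is_barnes_zeta2 tau (RtoC w) Z -> is_barnes_zeta2 tau (RtoC (w + 1)) Z' -> (2 < Re z)%R ->
  Csums (fun k => neg_pow (w + INR k * tau)%R z) (Z z - Z' z).
Proof.
  intros Ht Hw HZ HZ' Hz.
  destruct (barnes_zeta2_rows tau w Z z Ht Hw HZ Hz) as [row [Hrow Hsum]].
  destruct (barnes_zeta2_rows tau (w + 1) Z' z Ht ltac:(lra) HZ' Hz) as [row' [Hrow' Hsum']].
  assert (E : forall k, row' k = row (S k)).
  { intros k. eapply Csums_unique; [apply Hrow' |].
    eapply Csums_ext; [| apply (Hrow (S k))]. intros k2. cbv beta. f_equal. rewrite S_INR. ring. }
  assert (E2 : Z' z = Z z - row 0%nat).
  { eapply Csums_unique; [exact Hsum' |].
    eapply Csums_ext; [| apply (Csums_tail _ _ Hsum)]. intros k. now rewrite E. }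
  replace (Z z - Z' z) with (row 0%nat) by (rewrite E2; ring).
  eapply Csums_ext; [| apply (Hrow 0%nat)]. intros k. cbv beta. f_equal. change (INR 0) with 0%R. ring.
Qed.

(** The shift by [tau] removes the first term of every row. *)
Lemma barnes_zeta2_shift_tau (tau w : R) (Z Z' : C -> C) (z : C) : (0 < tau)%R -> (0 < w)%R ->
  is_barnes_zeta2 tau (RtoC w) Z -> is_barnes_zeta2 tau (RtoC (w + tau)) Z' -> (2 < Re z)%R ->
  Csums (fun k => neg_pow (w + INR k)%R z) (Z z - Z' z).
Proof.
  intros Ht Hw HZ HZ' Hz.
  destruct (barnes_zeta2_rows tau w Z z Ht Hw HZ Hz) as [row [Hrow Hsum]].
  destruct (barnes_zeta2_rows tau (w + tau) Z' z Ht ltac:(lra) HZ' Hz) as [row' [Hrow' Hsum']].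
  assert (E : forall k, row' k = row k - neg_pow (w + INR k)%R z).
  { intros k. eapply Csums_unique; [apply Hrow' |].
    pose proof (Csums_tail _ _ (Hrow k)) as T. cbv beta in T.
    replace (w + INR k + INR 0 * tau)%R with (w + INR k)%R in T by (simpl; ring).
    eapply Csums_ext; [| exact T]. intros k2. cbv beta. f_equal. rewrite S_INR. ring. }
  eapply Csums_ext; [| exact (Csums_minus _ _ _ _ Hsum Hsum')].
  intros k. cbv beta. rewrite E. ring.
Qed.

Lemma barnes_zeta2_on_segment (tau : R) (w : C) (Z : C -> C) :
  is_barnes_zeta2 tau w Z -> analytic_on_segment Z.
Proof.
  intros [H _] t Ht.
  assert (Him : Im (RtoC t * segment_end) = t) by (unfold segment_end, Im, Cmult, RtoC; simpl; ring).
  apply H; intros E; rewrite E in Him; simpl in Him; subst t;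
    apply (f_equal Re) in E; rewrite Re_segment_end in E; simpl in E; lra.
Qed.

Lemma on_segment_minus (f g : C -> C) :
  analytic_on_segment f -> analytic_on_segment g -> analytic_on_segment (fun z => f z - g z).
Proof. intros Hf Hg t Ht. apply analytic_minus; auto. Qed.

Lemma barnes_gamma2_value (tau w : R) (G2 : C -> C) : is_barnes_gamma2 tau G2 -> (0 < w)%R ->
  exists (Z : C -> C) (l : C),
    is_barnes_zeta2 tau (RtoC w) Z /\ Cderiv Z (RtoC 0) l /\ G2 (RtoC w) = Cexp l.
Proof. intros [_ H] Hw. apply H. exact Hw. Qed.

Lemma barnes_gamma2_neq_0 (tau w : R) (G2 : C -> C) :
  is_barnes_gamma2 tau G2 -> (0 < w)%R -> G2 (RtoC w) <> 0.
Proof.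
  intros HG Hw. destruct (barnes_gamma2_value tau w G2 HG Hw) as (Z & l & _ & _ & ->).
  apply Cexp_neq_0.
Qed.

(** A pole would give the value 0, but the value is an exponential. *)
Lemma barnes_gamma2_analytic (tau w : R) (G2 : C -> C) :
  is_barnes_gamma2 tau G2 -> (0 < w)%R -> analytic_at G2 (RtoC w).
Proof.
  intros HG Hw. destruct (proj1 HG (RtoC w)) as [H | [H _]]; [exact H |].
  now destruct (barnes_gamma2_neq_0 tau w G2 HG Hw).
Qed.

Lemma barnes_gamma2_at_1 (tau : R) (G2 : C -> C) : (0 < tau)%R -> is_barnes_gamma2 tau G2 ->
  G2 (RtoC 1) = RtoC (exp (- / 2 * ln (2 * PI))) * G2 (RtoC (1 + tau)).
Proof.
  intros Ht HG.
  destruct (barnes_gamma2_value tau 1 G2 HG ltac:(lra)) as (Z & l & HZ & Hl & ->).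
  destruct (barnes_gamma2_value tau (1 + tau) G2 HG ltac:(lra)) as (Z' & l' & HZ' & Hl' & ->).
  destruct (zeta_at_0 (fun z => Z z - Z' z) (l - l')) as [_ E].
  - apply on_segment_minus; eapply barnes_zeta2_on_segment; eassumption.
  - intros z Hz.
    eapply Csums_ext; [| exact (barnes_zeta2_shift_tau tau 1 Z Z' z Ht Rlt_0_1 HZ HZ' Hz)].
    intros k. cbv beta. f_equal. rewrite S_INR. ring.
  - now apply Cderiv_minus.
  - rewrite <- Cexp_RtoC, <- E, <- Cexp_add. f_equal. ring.
Qed.

(** The sum of the [(tau + k tau)^(-z)] is [tau^(-z) zeta z], so [tau^z] times the
    difference of the double zeta functions is the Riemann zeta function. *)
Lemma barnes_gamma2_at_tau (tau : R) (G2 : C -> C) : (0 < tau)%R -> is_barnes_gamma2 tau G2 ->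
  G2 (RtoC tau) = RtoC (exp (- / 2 * ln (2 * PI) + / 2 * ln tau)) * G2 (RtoC (tau + 1)).
Proof.
  intros Ht HG.
  destruct (barnes_gamma2_value tau tau G2 HG Ht) as (Z & l & HZ & Hl & ->).
  destruct (barnes_gamma2_value tau (tau + 1) G2 HG ltac:(lra)) as (Z' & l' & HZ' & Hl' & ->).
  set (e := fun z => Cexp (RtoC (ln tau) * z)).
  assert (He : Cderiv e (RtoC 0) (RtoC (ln tau))).
  { pose proof (Cderiv_exp (ln tau) 0) as H.
    replace (RtoC (ln tau) * 0) with (RtoC 0) in H by ring. rewrite Cexp_0 in H.
    replace (RtoC (ln tau) * 1) with (RtoC (ln tau)) in H by ring. exact H. }
  assert (He0 : e 0 = 1).
  { unfold e. replace (RtoC (ln tau) * 0) with (RtoC 0) by ring. apply Cexp_0. }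
  destruct (zeta_at_0 (fun z => e z * (Z z - Z' z))
     (RtoC (ln tau) * (Z 0 - Z' 0) + e 0 * (l - l'))) as [E0 E].
  - intros t Htt. apply analytic_mult; [apply analytic_exp |].
    apply on_segment_minus; [eapply barnes_zeta2_on_segment, HZ
      | eapply barnes_zeta2_on_segment, HZ' | exact Htt].
  - intros z Hz.
    eapply Csums_ext;
      [| exact (Csums_scal (e z) _ _ (barnes_zeta2_shift_1 tau tau Z Z' z Ht Ht HZ HZ' Hz))].
    intros k. cbv beta.
    replace (tau + INR k * tau)%R with (tau * INR (S k))%R by (rewrite S_INR; ring).
    rewrite neg_pow_mult by (try (apply lt_0_INR; lia); exact Ht).
    assert (K : e z * neg_pow tau z = 1).
    { unfold e, neg_pow. rewrite <- Cexp_add, <- Cexp_0. f_equal. rewrite RtoC_opp. ring. }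
    replace (e z * (neg_pow tau z * neg_pow (INR (S k)) z))
      with (e z * neg_pow tau z * neg_pow (INR (S k)) z) by ring.
    rewrite K. ring.
  - apply (Cderiv_mult e (fun z => Z z - Z' z)); [exact He | now apply Cderiv_minus].
  - rewrite He0 in E0, E. replace (1 * (Z 0 - Z' 0)) with (Z 0 - Z' 0) in E0 by ring.
    rewrite E0 in E.
    rewrite <- Cexp_RtoC, <- Cexp_add. f_equal.
    rewrite RtoC_plus, <- E, RtoC_mult, RtoC_opp. ring.
Qed.

(** The difference of the zeta differences at [w] and [w + 1] is the single term
    [w^(-z)], with derivative [- ln w] at 0. *)
Lemma barnes_gamma2_double_shift (tau w : R) (G2 : C -> C) :
  (0 < tau)%R -> is_barnes_gamma2 tau G2 -> (0 < w)%R ->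
  RtoC w * G2 (RtoC w) * G2 (RtoC (w + 1 + tau)) = G2 (RtoC (w + tau)) * G2 (RtoC (w + 1)).
Proof.
  intros Ht HG Hw.
  destruct (barnes_gamma2_value tau w G2 HG Hw) as (Z1 & l1 & HZ1 & Hl1 & ->).
  destruct (barnes_gamma2_value tau (w + tau) G2 HG ltac:(lra)) as (Z2 & l2 & HZ2 & Hl2 & ->).
  destruct (barnes_gamma2_value tau (w + 1) G2 HG ltac:(lra)) as (Z3 & l3 & HZ3 & Hl3 & ->).
  destruct (barnes_gamma2_value tau (w + 1 + tau) G2 HG ltac:(lra)) as (Z4 & l4 & HZ4 & Hl4 & ->).
  destruct (continuation_unique (fun z => (Z1 z - Z2 z) - (Z3 z - Z4 z)) (neg_pow w))
    as [r [Hr E]].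
  - repeat apply on_segment_minus; eapply barnes_zeta2_on_segment; eassumption.
  - intros t _. apply analytic_neg_pow.
  - intros z Hz.
    pose proof (barnes_zeta2_shift_tau tau w Z1 Z2 z Ht Hw HZ1 HZ2 Hz) as H1.
    pose proof (barnes_zeta2_shift_tau tau (w + 1) Z3 Z4 z Ht ltac:(lra) HZ3 HZ4 Hz) as H3.
    pose proof (Csums_tail _ _ H1) as H2. cbv beta in H2.
    replace (w + INR 0)%R with w in H2 by (simpl; ring).
    assert (K : Z3 z - Z4 z = Z1 z - Z2 z - neg_pow w z).
    { eapply Csums_unique; [exact H3 |]. eapply Csums_ext; [| exact H2].
      intros k. cbv beta. f_equal. rewrite S_INR. ring. }
    rewrite K. ring.
  - assert (U : (l1 - l2) - (l3 - l4) = RtoC (- ln w)).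
    { apply (Cderiv_unique (neg_pow w) 0); [| apply Cderiv_neg_pow_0].
      apply (Cderiv_near (fun z => (Z1 z - Z2 z) - (Z3 z - Z4 z)) _ 0 _ r Hr E).
      apply (Cderiv_minus (fun z => Z1 z - Z2 z) (fun z => Z3 z - Z4 z));
        now apply Cderiv_minus. }
    replace (RtoC w) with (Cexp (RtoC (ln w))) by (rewrite Cexp_RtoC, exp_ln; auto).
    rewrite <- !Cexp_add. f_equal.
    replace (l2 + l3) with (l1 + l4 - (l1 - l2 - (l3 - l4))) by ring.
    rewrite U, RtoC_opp. ring.
Qed.

Lemma analytic_shift (f : C -> C) (c z0 : C) :
  analytic_at f (z0 + c) -> analytic_at (fun z => f (z + c)) z0.
Proof.
  intros [a [r H]]. exists a, r. intros z Hz.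
  replace (z - z0) with (z + c - (z0 + c)) by ring. apply H.
  replace (z + c - (z0 + c)) with (z - z0) by ring. exact Hz.
Qed.

Lemma analytic_pow_id (n : nat) (z0 : C) : analytic_at (fun z => z ^ n) z0.
Proof.
  eapply analytic_of_expands, expands_pow, (expands_id z0 1), Rlt_0_1.
Qed.

Lemma analytic_eq_at_0 (f g : C -> C) (d : R) :
  analytic_at f 0 -> analytic_at g 0 -> (0 < d)%R ->
  (forall h : R, (0 < h < d)%R -> f (RtoC h) = g (RtoC h)) -> f 0 = g 0.
Proof.
  intros Hf Hg Hd H.
  destruct (analytic_vanish_near (fun z => f z - g z) 0 1 d) as [r [Hr K]].
  - now apply analytic_minus.
  - intros E. apply RtoC_inj in E. lra.
  - exact Hd.
  - intros h Hh. replace (0 + RtoC h * 1) with (RtoC h) by ring. rewrite H by exact Hh. ring.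
  - specialize (K 0). replace (f 0) with (f 0 - g 0 + g 0) by ring. rewrite K; [ring |].
    replace (0 - 0) with (RtoC 0) by ring. now rewrite Cmod_0.
Qed.

(** Both sides of the double shift identity, multiplied by [w^n] if there is a pole of
    order [n + 1], are analytic functions of [w] at 0 that agree for small [w > 0].  At
    [w = 0] the right-hand side [Gamma_2 (tau) Gamma_2 (1)] is nonzero, which excludes
    both analyticity and [n >= 1]. *)
Lemma barnes_gamma2_pole_at_0 (tau : R) (G2 : C -> C) :
  (0 < tau)%R -> is_barnes_gamma2 tau G2 ->
  G2 0 = 0 /\
  exists (g : C -> C) (r : R), (0 < r)%R /\ analytic_at g 0 /\ g 0 <> 0 /\
    (forall z : C, z <> 0 -> (Cmod z < r)%R -> G2 z = g z / z) /\
    g 0 * G2 (RtoC (1 + tau)) = G2 (RtoC tau) * G2 (RtoC 1).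
Proof.
  intros Ht HG.
  assert (Hs : forall c : R, (0 < c)%R -> analytic_at (fun z => G2 (z + RtoC c)) 0).
  { intros c Hc. apply analytic_shift. replace (0 + RtoC c) with (RtoC c) by ring.
    now apply (barnes_gamma2_analytic tau). }
  assert (Hright : analytic_at (fun z => G2 (z + RtoC tau) * G2 (z + RtoC 1)) 0)
    by (apply (analytic_mult (fun z => G2 (z + RtoC tau)) (fun z => G2 (z + RtoC 1)));
        apply Hs; lra).
  assert (H1t : analytic_at (fun z => G2 (z + RtoC (1 + tau))) 0) by (apply Hs; lra).
  assert (Hshift : forall h : R, (0 < h)%R ->
     RtoC h * G2 (RtoC h) * G2 (RtoC h + RtoC (1 + tau))
     = G2 (RtoC h + RtoC tau) * G2 (RtoC h + RtoC 1)).
  { intros h Hh. rewrite <- !RtoC_plus. replace (h + (1 + tau))%R with (h + 1 + tau)%R by ring.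
    now apply barnes_gamma2_double_shift. }
  assert (Hz : forall c : R, 0 + RtoC c = RtoC c) by (intros; ring).
  assert (Hne : G2 (RtoC tau) * G2 (RtoC 1) <> 0).
  { apply Cmult_neq_0; apply (barnes_gamma2_neq_0 tau); auto; lra. }
  destruct (proj1 HG 0) as [Han | [H0 (n & g & r & Hg & Hg0 & Hpole)]].
  - exfalso. apply Hne.
    pose proof (analytic_eq_at_0 (fun z => z ^ 1 * G2 z * G2 (z + RtoC (1 + tau)))
      (fun z => G2 (z + RtoC tau) * G2 (z + RtoC 1)) 1) as E.
    cbv beta in E. rewrite !Hz in E. rewrite <- E.
    + simpl. ring.
    + apply analytic_mult; [| exact H1t]. apply analytic_mult; [apply analytic_pow_id | exact Han].
    + exact Hright.
    + lra.
    + intros h Hh. rewrite <- Hshift by lra. simpl. ring.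
  - assert (E : g 0 * G2 (RtoC (1 + tau)) = 0 ^ n * (G2 (RtoC tau) * G2 (RtoC 1))).
    { pose proof (analytic_eq_at_0 (fun z => g z * G2 (z + RtoC (1 + tau)))
        (fun z => z ^ n * (G2 (z + RtoC tau) * G2 (z + RtoC 1))) r) as E.
      cbv beta in E. rewrite !Hz in E. apply E.
      - now apply analytic_mult.
      - apply analytic_mult; [apply analytic_pow_id | exact Hright].
      - apply cond_pos.
      - intros h Hh. rewrite <- Hshift by lra.
        assert (Hh0 : RtoC h <> 0) by (intros K; apply RtoC_inj in K; lra).
        assert (Hhn : RtoC h ^ n <> 0) by (now apply Cpow_nz).
        rewrite (Hpole (RtoC h) Hh0).
        + replace (RtoC h - 0) with (RtoC h) by ring. simpl. field. now split.
        + replace (RtoC h - 0) with (RtoC h) by ring. rewrite Cmod_RtoC_pos; lra. }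
    (* The order of the pole is [S n]; for [n >= 1] the factor [0 ^ n] is 0. *)
    destruct n as [|n].
    + split; [exact H0 |]. exists g, r. split; [apply cond_pos |].
      split; [exact Hg |]. split; [exact Hg0 |]. split.
      * intros z Hz0 Hzr. rewrite (Hpole z Hz0).
        -- replace (z - 0) with z by ring. simpl. now rewrite Cmult_1_r.
        -- replace (z - 0) with z by ring. exact Hzr.
      * rewrite E. simpl. ring.
    + exfalso. apply (Cmult_neq_0 (g 0) (G2 (RtoC (1 + tau)))).
      * exact Hg0.
      * apply (barnes_gamma2_neq_0 tau); auto; lra.
      * rewrite E. simpl. ring.
Qed.

(** * The derivative of Upsilon *)

Lemma Ccontinuous_comp (f g : C -> C) (z0 : C) :
  Ccontinuous g z0 -> Ccontinuous f (g z0) -> Ccontinuous (fun z => f (g z)) z0.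
Proof.
  intros Hg Hf eps He. destruct (Hf eps He) as [e [He2 H]].
  destruct (Hg e He2) as [d [Hd K]]. exists d. split; [exact Hd |]. intros z Hz.
  apply H, K, Hz.
Qed.

Lemma Ccontinuous_mult (f g : C -> C) (z0 : C) :
  Ccontinuous f z0 -> Ccontinuous g z0 -> Ccontinuous (fun z => f z * g z) z0.
Proof.
  intros Hf Hg eps He.
  set (A := (Cmod (f z0) + Cmod (g z0) + 1)%R).
  pose proof (Cmod_ge_0 (f z0)) as F0. pose proof (Cmod_ge_0 (g z0)) as G0.
  set (e := Rmin 1 (eps / (2 * A))).
  assert (He0 : (0 < e)%R).
  { apply Rmin_pos; [lra |]. apply Rdiv_lt_0_compat; unfold A; lra. }
  assert (He1 : (e <= 1)%R) by apply Rmin_l.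
  assert (He2 : (e * (2 * A) <= eps)%R).
  { replace eps with (eps / (2 * A) * (2 * A))%R by (field; unfold A; lra).
    apply Rmult_le_compat_r; [unfold A; lra | apply Rmin_r]. }
  destruct (Hf e He0) as [d1 [Hd1 K1]]. destruct (Hg e He0) as [d2 [Hd2 K2]].
  exists (Rmin d1 d2). split; [now apply Rmin_pos |]. intros z Hz.
  specialize (K1 z (Rlt_le_trans _ _ _ Hz (Rmin_l _ _))).
  specialize (K2 z (Rlt_le_trans _ _ _ Hz (Rmin_r _ _))).
  replace (f z * g z - f z0 * g z0)
    with ((f z - f z0) * (g z - g z0) + (f z - f z0) * g z0 + f z0 * (g z - g z0)) by ring.
  eapply Rle_lt_trans; [eapply Rle_trans; [apply Cmod_triangle |];
    apply Rplus_le_compat_r, Cmod_triangle |].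
  rewrite !Cmod_mult.
  pose proof (Cmod_ge_0 (f z - f z0)). pose proof (Cmod_ge_0 (g z - g z0)).
  unfold A in He2. nra.
Qed.

Lemma Ccontinuous_affine (a b z0 : C) : Ccontinuous (fun z => a * z + b) z0.
Proof.
  apply analytic_continuous.
  apply analytic_plus; [| apply analytic_const].
  apply (analytic_ext (fun z => a * z ^ 1)); [intros; simpl; ring |].
  apply (analytic_mult (fun _ => a)); [apply analytic_const | apply analytic_pow_id].
Qed.

Lemma Ccontinuous_Cexp (z0 : C) : Ccontinuous Cexp z0.
Proof.
  apply analytic_continuous, (analytic_ext (fun z => Cexp (RtoC 1 * z))); [| apply analytic_exp].
  intros z. f_equal. ring.
Qed.

Lemma Cderiv_id_div (F D : C -> C) (k : C) (r : R) :
  (0 < r)%R -> F 0 = 0 -> D 0 <> 0 -> Ccontinuous D 0 ->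
  (forall y : C, y <> 0 -> (Cmod y < r)%R -> D y <> 0 -> F y = y * (k / D y)) ->
  Cderiv F (RtoC 0) (k / D 0).
Proof.
  intros Hr HF0 HD0 HD HF. apply Cderiv_iff. intros eps He.
  pose proof (proj1 (Cmod_gt_0 (D 0)) HD0) as HM. set (m := Cmod (D 0)) in *.
  pose proof (Cmod_ge_0 k) as Hk.
  set (e := Rmin (m / 2) (eps * m * m / (2 * (Cmod k + 1)))).
  assert (He0 : (0 < e)%R).
  { apply Rmin_pos; [lra |]. apply Rdiv_lt_0_compat; [| lra].
    apply Rmult_lt_0_compat; [nra | lra]. }
  assert (He1 : (e <= m / 2)%R) by apply Rmin_l.
  assert (He2 : (e * (2 * (Cmod k + 1)) <= eps * m * m)%R).
  { replace (eps * m * m)%R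
      with (eps * m * m / (2 * (Cmod k + 1)) * (2 * (Cmod k + 1)))%R by (field; lra).
    apply Rmult_le_compat_r; [lra | apply Rmin_r]. }
  destruct (HD e He0) as [d [Hd K]].
  exists (Rmin r d). split; [now apply Rmin_pos |]. intros y Hy.
  replace (y - 0) with y in * by ring.
  pose proof (Rlt_le_trans _ _ _ Hy (Rmin_l _ _)) as Hy1.
  pose proof (Rlt_le_trans _ _ _ Hy (Rmin_r _ _)) as Hy2.
  rewrite HF0. replace (F y - 0 - y * (k / D 0)) with (F y - y * (k / D 0)) by ring.
  destruct (Ceq_dec y 0) as [-> | Hyne].
  - rewrite HF0. replace (0 - 0 * (k / D 0)) with (RtoC 0) by ring. rewrite Cmod_0. lra.
  - specialize (K y). replace (y - 0) with y in K by ring. specialize (K Hy2).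
    pose proof (Cmod_triangle (D y) (- (D y - D 0))) as T. rewrite Cmod_opp in T.
    replace (D y + - (D y - D 0)) with (D 0) in T by ring. fold m in T.
    assert (HDy : (m / 2 < Cmod (D y))%R) by lra.
    assert (HDy0 : D y <> 0) by (apply Cmod_gt_0; lra).
    rewrite (HF y Hyne Hy1 HDy0).
    replace (y * (k / D y) - y * (k / D 0)) with (- (y * (k * (D y - D 0)) / (D y * D 0)))
      by (field; split; assumption).
    rewrite Cmod_opp, Cmod_div by (now apply Cmult_neq_0).
    rewrite !Cmod_mult. fold m.
    pose proof (Cmod_ge_0 y) as Y0. pose proof (Cmod_ge_0 (D y - D 0)) as E0.
    assert (HP : (0 < Cmod (D y) * m)%R) by nra.
    apply (Rmult_le_reg_r (Cmod (D y) * m)); [exact HP |].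
    unfold Rdiv. rewrite Rmult_assoc, Rinv_l, Rmult_1_r by lra.
    replace (eps * Cmod y * (Cmod (D y) * m))%R with (Cmod y * (eps * m * Cmod (D y)))%R by ring.
    apply Rmult_le_compat_l; [exact Y0 |].
    apply Rle_trans with (eps * m * (m / 2))%R.
    + apply Rle_trans with ((Cmod k + 1) * e)%R; [nra | lra].
    + apply Rmult_le_compat_l; [nra | lra].
Qed.

(** The exponents add up: [2 * zeta' 0 + ln tau / 2 = ln (sqrt tau / (2 pi))]. *)
Lemma barnes_gamma2_residue (tau : R) (G2 : C -> C) (g0 : C) :
  (0 < tau)%R -> is_barnes_gamma2 tau G2 ->
  g0 * G2 (RtoC (1 + tau)) = G2 (RtoC tau) * G2 (RtoC 1) ->
  g0 = RtoC (sqrt tau / (2 * PI)) * G2 (RtoC (1 + tau)).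
Proof.
  intros Ht HG E. pose proof PI_RGT_0 as Hpi.
  pose proof (barnes_gamma2_neq_0 tau (1 + tau) G2 HG ltac:(lra)) as Hne.
  rewrite (barnes_gamma2_at_1 tau G2 Ht HG), (barnes_gamma2_at_tau tau G2 Ht HG) in E.
  rewrite (Rplus_comm tau 1) in E.
  assert (Ee : RtoC (sqrt tau / (2 * PI)) = RtoC (exp (- / 2 * ln (2 * PI) + / 2 * ln tau))
                 * RtoC (exp (- / 2 * ln (2 * PI)))).
  { rewrite <- RtoC_mult, <- exp_plus. f_equal.
    replace (- / 2 * ln (2 * PI) + / 2 * ln tau + - / 2 * ln (2 * PI))%R
      with (ln tau * / 2 + - ln (2 * PI))%R by field.
    rewrite exp_plus, exp_half_ln, exp_Ropp, exp_ln by lra. reflexivity. }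
  rewrite Ee.
  replace g0 with (g0 * G2 (RtoC (1 + tau)) / G2 (RtoC (1 + tau))) by (field; exact Hne).
  rewrite E. field. exact Hne.
Qed.

Theorem lemma5p2 (gamma : R) (hgamma : (0 < gamma < 2)%R)
  (G2 : C -> C) (hG2 : is_barnes_gamma2 (4 / gamma ^ 2)%R G2) :
  @is_derive C_AbsRing C_NormedModule (Upsilon gamma G2) (RtoC 0)
    (RtoC (2 * PI) / (double_gamma gamma G2 (RtoC (Qgamma gamma))) ^ 2)%C.
Proof.
  set (tau := (4 / gamma ^ 2)%R) in *. set (c := (2 / gamma)%R).
  assert (Hc : (0 < c)%R) by (apply Rdiv_lt_0_compat; lra).
  assert (Hg : RtoC gamma <> 0) by (intros E; apply RtoC_inj in E; lra).
  assert (Hcg : RtoC c = 2 / RtoC gamma) by (unfold c; rewrite RtoC_div by lra; reflexivity).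
  assert (Htc : tau = (c * c)%R) by (unfold tau, c; field; lra).
  assert (Ht : (0 < tau)%R) by (rewrite Htc; nra).
  assert (HcQ : (c * Qgamma gamma = 1 + tau)%R) by (unfold Qgamma, tau, c; field; lra).
  assert (HQ : (0 < Qgamma gamma)%R) by (apply (Rmult_lt_reg_l c); lra).
  set (q := G2 (Qgamma gamma / gamma)).
  assert (Hq : q <> 0).
  { unfold q. rewrite <- RtoC_div by lra. apply (barnes_gamma2_neq_0 tau); [exact hG2 |].
    apply Rdiv_lt_0_compat; lra. }
  set (p := fun x : C => Cpower (RtoC c) (/ 2 * (x - Qgamma gamma / 2) ^ 2)).
  assert (Hp0 : forall x, p x <> 0) by (intros x; apply Cexp_neq_0).
  (* The Gaussian prefactor is symmetric under [x -> Q - x]. *)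
  assert (Hpsym : forall x, p (RtoC (Qgamma gamma) - x) = p x).
  { intros x. unfold p. f_equal. simpl. field. }
  assert (Hdg : forall x, double_gamma gamma G2 x = p x * (G2 (RtoC c * x) / q)).
  { intros x. unfold double_gamma. fold q. fold c. fold (p x). do 3 f_equal.
    rewrite Hcg. field. exact Hg. }
  destruct (barnes_gamma2_pole_at_0 tau G2 Ht hG2) as [HG0 (g & r & Hr & Hgan & Hg0 & Hgp & Hres)].
  apply (barnes_gamma2_residue tau G2 (g 0) Ht hG2) in Hres.
  pose proof (barnes_gamma2_neq_0 tau (1 + tau) G2 hG2 ltac:(lra)) as Hne.
  set (D := fun y : C => p y * p y * (g (RtoC c * y + 0) *
      G2 (- RtoC c * y + RtoC c * RtoC (Qgamma gamma)))).
  assert (HD0 : D 0 = p 0 * p 0 * (g 0 * G2 (RtoC (1 + tau)))).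
  { unfold D. rewrite <- HcQ, RtoC_mult.
    replace (RtoC c * 0 + 0) with (RtoC 0) by ring.
    replace (- RtoC c * 0 + RtoC c * RtoC (Qgamma gamma))
      with (RtoC c * RtoC (Qgamma gamma)) by ring. reflexivity. }
  assert (Hpcont : Ccontinuous p 0).
  { unfold p, Cpower.
    set (L := Clog (RtoC c)).
    apply (Ccontinuous_comp Cexp); [| apply Ccontinuous_Cexp].
    apply analytic_continuous.
    apply (analytic_mult _ (fun _ => L)); [| apply analytic_const].
    apply (analytic_mult (fun _ => / 2)); [apply analytic_const |].
    apply (analytic_shift (fun z => z ^ 2)), analytic_pow_id. }
  assert (HDcont : Ccontinuous D 0).
  { apply Ccontinuous_mult; [now apply Ccontinuous_mult |]. apply Ccontinuous_mult.
    - apply (Ccontinuous_comp g); [apply Ccontinuous_affine |].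
      replace (RtoC c * 0 + 0) with (RtoC 0) by ring. now apply analytic_continuous.
    - apply (Ccontinuous_comp G2); [apply Ccontinuous_affine |].
      replace (- RtoC c * 0 + RtoC c * RtoC (Qgamma gamma)) with (RtoC (1 + tau))
        by (rewrite <- HcQ, RtoC_mult; ring).
      apply analytic_continuous, (barnes_gamma2_analytic tau); [exact hG2 | lra]. }
  assert (HD0ne : D 0 <> 0).
  { rewrite HD0. repeat apply Cmult_neq_0; auto. }
  assert (Hpi : RtoC (2 * PI) <> 0).
  { intros E. apply RtoC_inj in E. pose proof PI_RGT_0. lra. }
  assert (Hc0 : RtoC c <> 0) by (intros E; apply RtoC_inj in E; lra).
  replace (RtoC (2 * PI) / double_gamma gamma G2 (RtoC (Qgamma gamma)) ^ 2)
    with (RtoC c * (q * q) / D 0).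
  2:{ rewrite HD0, Hdg, Hres, <- RtoC_mult, HcQ.
      replace (p (RtoC (Qgamma gamma))) with (p 0)
        by (rewrite <- Hpsym; f_equal; ring).
      rewrite Htc at 1. rewrite sqrt_square by lra. rewrite RtoC_div by (pose proof PI_RGT_0; lra).
      simpl. field. repeat split; auto. }
  apply (Cderiv_id_div _ D _ (r / c)).
  - apply Rdiv_lt_0_compat; assumption.
  - (* [G2] is 0 at its pole, and the inverse of 0 is 0. *)
    unfold Upsilon. rewrite (Hdg 0). replace (RtoC c * 0) with (RtoC 0) by ring. rewrite HG0.
    match goal with |- RtoC 1 / ?x = RtoC 0 => replace x with (RtoC 0) by (field; exact Hq) end.
    unfold Cdiv, Cinv, Cmult, RtoC. simpl. f_equal; unfold Rdiv; ring.
  - exact HD0ne.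
  - exact HDcont.
  - intros y Hy0 Hyr HDy. unfold Upsilon. rewrite !Hdg, Hpsym.
    assert (Hcy : RtoC c * y <> 0) by (now apply Cmult_neq_0).
    rewrite (Hgp (RtoC c * y)); [| exact Hcy |].
    2:{ rewrite Cmod_mult, Cmod_RtoC_pos by lra.
        apply (Rmult_lt_compat_l c) in Hyr; [| exact Hc].
        replace (c * (r / c))%R with r in Hyr by (field; lra). exact Hyr. }
    unfold D in *.
    replace (RtoC c * y + 0) with (RtoC c * y) in * by ring.
    replace (- RtoC c * y + RtoC c * RtoC (Qgamma gamma))
      with (RtoC c * (RtoC (Qgamma gamma) - y)) in * by ring.
    set (a := g (RtoC c * y)) in *. set (b := G2 (RtoC c * (RtoC (Qgamma gamma) - y))) in *.
    assert (Ha : a <> 0) by (intros E; apply HDy; rewrite E; ring).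
    assert (Hb : b <> 0) by (intros E; apply HDy; rewrite E; ring).
    field. repeat split; auto.
Qed.
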